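(* Let $\{G_i\}_{i=1}^\infty$ be an s-convergent sequence of finite graphs with non-empty edge sets. Then there is a Borel probability measure $\mu$ on $[0,1]^2$ such that for every natural number $k$, the limit of the sets $C_0(G_i,k)$ in the Hausdorff metric as $i\to\infty$ is $C(\mu,k)$.
   Context: Natural numbers $k$ are positive. $\mathcal{K}(k,n)$ is the set of all non-negative real $k\times n$ matrices with every row sum equal to $n/k$ and every column sum equal to $1$. For an $n\times n$ matrix $S$, $C(S,k)=\{MSM^T : M\in\mathcal{K}(k,n)\}\subset\mathbb{R}^{k\times k}$. For a finite graph $G$ with non-empty edge set and adjacency matrix $A_G$, $C_0(G,k)=\|A_G\|_1^{-1}\,C(A_G,k)$, where $\|A_G\|_1$ is the sum of the absolute values of the entries of $A_G$. A sequence $\{G_i\}$ of such graphs is s-convergent if for every natural number $k$ the sets $C_0(G_i,k)$ converge in the Hausdorff metric (on compact subsets of $\mathbb{R}^{k\times k}$, induced by the entrywise $\ell_1$ norm). For a finite Borel measure $\mu$ on $[0,1]^2$, $C(\mu,k)$ is the topological closure in $\mathbb{R}^{k\times k}$ of the set of all $k\times k$ matrices $M$ with $M(i,j)=\int_{[0,1]^2} f_i(x)f_j(y)\,d\mu(x,y)$, where $f_1,\dots,f_k$ range over all families of non-negative Borel measurable functions on $[0,1]$ with $\sum_{i=1}^k f_i=1$ everywhere and $\int_0^1 f_i\,d\lambda=1/k$ for each $i$ ($\lambda$ is Lebesgue measure). *)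

(* Defs.v *)
From HB Require Import structures.
From mathcomp Require Import all_boot all_order all_algebra.
From mathcomp Require Import all_classical all_reals all_analysis.

Set Implicit Arguments.
Unset Strict Implicit.
Unset Printing Implicit Defensive.

Import Order.TTheory GRing.Theory Num.Theory.
Import numFieldNormedType.Exports.

Local Open Scope classical_set_scope.
Local Open Scope ring_scope.

Record graph := Graph {
  vertex :> finType;
  edge : rel vertex;
  edge_sym : symmetric edge;
  edge_irr : irreflexive edge }.

Definition has_edge (G : graph) : Prop := exists x y : G, edge x y.

Definition adjacency (R : realType) (G : graph) : 'M[R]_#|G| :=
  \matrix_(i, j) (edge (enum_val i) (enum_val j))%:R.

Definition l1norm (R : realType) (m n : nat) (A : 'M[R]_(m, n)) : R :=
  \sum_i \sum_j `|A i j|.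

Definition Kset (R : realType) (k n : nat) : set 'M[R]_(k, n) :=
  [set M | [/\ forall a i, 0 <= M a i,
               forall a, \sum_i M a i = n%:R / k%:R
             & forall i, \sum_a M a i = 1] ].

Arguments Kset R k n : clear implicits.

Definition Cmx (R : realType) (n : nat) (S : 'M[R]_n) (k : nat) :
    set 'M[R]_k :=
  [set M *m S *m M^T | M in Kset R k n].

Arguments Cmx {R n} S k.

Definition C0 (R : realType) (G : graph) (k : nat) : set 'M[R]_k :=
  [set (l1norm (adjacency R G))^-1 *: X | X in Cmx (adjacency R G) k].

Arguments C0 R G k : clear implicits.

(* Extended-real valued, so that no junk value arises from empty or unbounded
   sets; only nonempty compact sets matter below. *)
Definition hausdorff_dist (R : realType) (k : nat) (A B : set 'M[R]_k) :
    \bar R :=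
  Order.max
    (ereal_sup [set ereal_inf [set (l1norm (x - y))%:E | y in B] | x in A])
    (ereal_sup [set ereal_inf [set (l1norm (x - y))%:E | x in A] | y in B]).

(* [L] is the limit of the sequence [A] in the space of nonempty compact
   sets. *)
Definition hausdorff_limit (R : realType) (k : nat)
    (A : nat -> set 'M[R]_k) (L : set 'M[R]_k) : Prop :=
  [/\ L !=set0, compact L & hausdorff_dist (A i) L @[i --> \oo] --> 0%E].

Definition s_convergent (R : realType) (G : nat -> graph) : Prop :=
  forall k, (0 < k)%N ->
    exists L : set 'M[R]_k, hausdorff_limit (fun i => C0 R (G i) k) L.

Arguments s_convergent R G : clear implicits.

Definition unit_interval (R : realType) : set (measurableTypeR R) :=
  `[0, 1]%classic.

Arguments unit_interval R : clear implicits.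

Definition unit_square (R : realType) :
    set (measurableTypeR R * measurableTypeR R)%type :=
  unit_interval R `*` unit_interval R.

Arguments unit_square R : clear implicits.

Definition fractional_partition (R : realType) (k : nat)
    (f : 'I_k -> measurableTypeR R -> R) : Prop :=
  [/\ forall i, measurable_fun (unit_interval R) (f i),
      forall i x, unit_interval R x -> 0 <= f i x,
      forall x, unit_interval R x -> \sum_i f i x = 1
    & forall i, (\int[@lebesgue_measure R]_(x in unit_interval R) (f i x)%:E
                 = (k%:R^-1)%:E)%E ].

(* A Borel measure on [0,1]^2 is represented by a measure on the plane; only
   its restriction to the unit square is used here. *)
Definition Cmeas (R : realType)
    (mu : {measure set (measurableTypeR R * measurableTypeR R) -> \bar R})
    (k : nat) : set 'M[R]_k :=
  closure [set M : 'M[R]_k |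
    exists2 f : 'I_k -> measurableTypeR R -> R, fractional_partition f &
      forall i j, (M i j)%:E =
        (\int[mu]_(p in unit_square R) (f i p.1 * f j p.2)%:E)%E ].

Arguments Cmeas {R} mu k.

(* Main.v *)
Require Import Defs.
From HB Require Import structures.
From mathcomp Require Import all_boot all_order all_algebra.
From mathcomp Require Import all_classical all_reals all_analysis.
From mathcomp Require Import ring lra measurable_realfun.
Import Order.TTheory GRing.Theory Num.Theory.
Import numFieldNormedType.Exports.
Local Open Scope classical_set_scope.
Local Open Scope ring_scope.

Set Implicit Arguments.
Unset Strict Implicit.
Unset Printing Implicit Defensive.

(** The limit measure is built from random words. Fix [G i] and attach to each
vertex [v] an infinite word whose letters are independent given [v]. For odd
[j] the letter number [j] equals [a] with probability [M a v], where [M] is an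
element of K(k,n) whose normalized statistic M A M^T is within [1/(N+1)] of a
rational matrix [q], whenever such an [M] exists; the triples (k, q, N) are
enumerated by [j]. For even [j] the letter is a fair coin. A uniform random
vertex yields a law on words, a uniform random edge a law on pairs of words,
and the limits of these laws along an ultrafilter of indices are the weights
[limit_weight] and [limit_pair_weight].

The two laws have to be carried to [0,1] so that the first becomes Lebesgue
measure, while words remain functions of points and points of words. Nested
intervals do this for the vertex law: the coins make it nonatomic, so
Lebesgue-almost every point [x] is recovered from its digits. The edge law,
however, may be singular with respect to the vertex law (all edges of a star
meet a negligible set of vertices), and it may charge sequences that the
interval coding collapses. Such sequences are sent instead into a
Lebesgue-null Cantor set ([sparse_set]). The resulting map [encode] has the
left inverse [decode] on all sequences of letters, and since only a null set was reserved
for the exceptional ones, [encode] still carries the vertex law to Lebesgue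
measure. The measure of the theorem is the image of the edge law.

Let L be the Hausdorff limit of the sets C_0(G_i,k). The indicators of the
values of one letter form a fractional partition of [0,1] whose matrix is
the ultralimit of the chosen statistics; letting (q, N) vary, these matrices
come arbitrarily close to every point of L ([limit_subset_Cmeas]). Conversely,
a fractional partition of [0,1], read as a function of the letter sequence, is
approximated in measure, for the vertex law and both edge marginals, by a
partition depending on a finite prefix, because cylinders generate the Borel
sets ([measurable_cylinder_approximable], [approximate_partition]). Averaging
this prefix partition over the random word of each vertex gives fractional
partitions of the graphs [G i] with nearly the right matrix and nearly the
right row sums; [adjust_to_Kset] corrects the row sums, so that the matrix is
within any distance of L, which is closed ([Cmeas_subset_limit]). *)

(** * Words and nested interval codings *)

(** Words carry their most recent letter first: appending a letter to a prefix is
then a cons, and functions of words can be defined by structural recursion. *)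
Fixpoint prefix_word (w : nat -> nat) (m : nat) : seq nat :=
  if m is m'.+1 then w m' :: prefix_word w m' else [::].

Lemma size_prefix_word w m : size (prefix_word w m) = m.
Proof. by elim: m => //= m ->. Qed.

Lemma drop_prefix_word w m m' : (m <= m')%N ->
  drop (m' - m) (prefix_word w m') = prefix_word w m.
Proof.
move=> mm'; rewrite -{2}(subnK mm'); elim: (m' - m)%N => [|k IH]; first by rewrite drop0.
by rewrite addSn.
Qed.

Fixpoint words (n : nat -> nat) (m : nat) : seq (seq nat) :=
  if m is m'.+1 then [seq a :: w | w <- words n m', a <- iota 0 (n m')]
  else [:: [::]].

Lemma words_size n m w : w \in words n m -> size w = m.
Proof.
elim: m w => [|m IH] w /=; first by rewrite inE => /eqP ->.
by case/allpairsPdep => v [a [vm _ ->]] /=; rewrite IH.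
Qed.

Lemma words_cons n m a w :
  (a :: w \in words n m.+1) = (w \in words n m) && (a < n m)%N.
Proof.
apply/allpairsPdep/andP => /= [[v [b [vm]]]|[wm an]].
  by rewrite mem_iota /= add0n => bn [-> ->].
by exists w, a; rewrite mem_iota.
Qed.

Lemma words_uniq n m : uniq (words n m).
Proof.
elim: m => [//|m IH] /=; apply: allpairs_uniq => //; first exact: iota_uniq.
by move=> [w a] [v b] _ _ /= [-> ->].
Qed.

Lemma prefix_word_in n w m : (forall j, (w j < n j)%N) ->
  prefix_word w m \in words n m.
Proof.
by move=> wn; elim: m => [|m IH] //=; rewrite -/(words n m.+1) words_cons IH wn.
Qed.

Lemma sum_words_recr (V : nmodType) n m (F : seq nat -> V) :
  \sum_(w <- words n m.+1) F w =
  \sum_(w <- words n m) \sum_(a < n m) F (nat_of_ord a :: w).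
Proof.
rewrite big_allpairs_dep /=; apply: eq_bigr => w _.
by rewrite -(big_mkord xpredT (fun a => F (a :: w))) /index_iota subn0.
Qed.

Section interval_coding.
Variables (R : realType) (n : nat -> nat) (p : seq nat -> R).
Hypothesis n_gt0 : forall j, (0 < n j)%N.
Hypothesis p_ge0 : forall w, 0 <= p w.
Hypothesis p_nil : p [::] = 1.
Hypothesis p_split : forall w, p w = \sum_(a < n (size w)) p (nat_of_ord a :: w).

(** The cell of a word [w] is the half-open interval of length [p w] starting here:
the cells of the one-letter extensions of [w] are laid side by side, in the
order of the letters, inside the cell of [w]. *)
Fixpoint left_end (w : seq nat) : R :=
  if w is a :: w' then left_end w' + \sum_(b < a) p (nat_of_ord b :: w') else 0.

Definition in_cell (w : seq nat) (x : R) :=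
  left_end w <= x < left_end w + p w.

(** The search stops before the last letter, which is the default value; so the
result is always an admissible letter, even for [x] outside the cell of [w]. *)
Definition next_letter (w : seq nat) (x : R) : nat :=
  find (fun a => x < left_end (a :: w) + p (a :: w)) (iota 0 (n (size w)).-1).

Fixpoint code (x : R) (m : nat) : seq nat :=
  if m is m'.+1 then next_letter (code x m') x :: code x m' else [::].

Definition digits (x : R) (j : nat) : nat := next_letter (code x j) x.

Lemma prefix_digits x m : prefix_word (digits x) m = code x m.
Proof. by elim: m => //= m ->. Qed.

Lemma size_code x m : size (code x m) = m.
Proof. by rewrite -prefix_digits size_prefix_word. Qed.

Lemma digits_lt x j : (digits x j < n j)%N.
Proof.
rewrite /digits /next_letter size_code.
apply: (@leq_ltn_trans (n j).-1); last by rewrite prednK.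
by apply: leq_trans (find_size _ _) _; rewrite size_iota.
Qed.

Lemma code_in_words x m : code x m \in words n m.
Proof. by rewrite -prefix_digits; apply: prefix_word_in => j; exact: digits_lt. Qed.

Lemma right_endS a w :
  left_end (a.+1 :: w) = left_end (a :: w) + p (a :: w).
Proof. by rewrite /= big_ord_recr /= addrA. Qed.

Lemma left_end_mono a b w : (a <= b)%N -> left_end (a :: w) <= left_end (b :: w).
Proof.
elim: b => [|b IH]; first by rewrite leqn0 => /eqP ->.
rewrite leq_eqVlt ltnS => /orP[/eqP -> //|/IH ab].
by rewrite right_endS (le_trans ab)// lerDl.
Qed.

Lemma left_end_full w : left_end (n (size w) :: w) = left_end w + p w.
Proof. by rewrite /= -p_split. Qed.

Lemma left_end_ge0 w : 0 <= left_end w.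
Proof. by elim: w => //= a w IH; rewrite addr_ge0// sumr_ge0. Qed.

Lemma in_cell_tail a w x : (a < n (size w))%N -> in_cell (a :: w) x -> in_cell w x.
Proof.
move=> an /andP[lx xr]; apply/andP; split.
  by apply: le_trans lx; rewrite /= lerDl sumr_ge0.
by rewrite -left_end_full (lt_le_trans xr)// -right_endS left_end_mono.
Qed.

Lemma in_cell_inj a b w x : in_cell (a :: w) x -> in_cell (b :: w) x -> a = b.
Proof.
suff lt_ab c d : in_cell (c :: w) x -> in_cell (d :: w) x -> ~~ (c < d)%N.
  move=> ca cb; apply/eqP; rewrite eqn_leq leqNgt lt_ab//=.
  by rewrite leqNgt lt_ab.
move=> /andP[_ xc] /andP[dx _]; apply/negP => cd.
have := left_end_mono w cd; rewrite right_endS leNgt => /negP; apply.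
exact: le_lt_trans dx xc.
Qed.

Lemma next_letter_cell w x : in_cell w x -> in_cell (next_letter w x :: w) x.
Proof.
move=> /andP[lx xr]; rewrite /next_letter.
set P := (fun a => _); set s := iota _ _; set c := find P s.
have c_le : (c <= (n (size w)).-1)%N by rewrite -[leqRHS](size_iota 0) find_size.
have nE : (n (size w)).-1.+1 = n (size w) by rewrite prednK.
apply/andP; split.
  case Ec : c => [|c']; first by rewrite /= big_ord0 addr0.
  rewrite right_endS leNgt.
  have c's : (c' < c)%N by rewrite Ec.
  have := before_find 0%N c's; rewrite nth_iota ?add0n ?(leq_trans c's)//.
  by move=> /negbT.
case: (ltnP c (n (size w)).-1) => [c_lt|c_ge].
  have hs : has P s by rewrite has_find size_iota.
  by have := nth_find 0%N hs; rewrite nth_iota ?add0n.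
have -> : c = (n (size w)).-1 by apply/eqP; rewrite eqn_leq c_le.
by rewrite -right_endS nE left_end_full.
Qed.

Lemma in_cell_nil x : in_cell [::] x = (0 <= x < 1).
Proof. by rewrite /in_cell /= add0r p_nil. Qed.

Lemma code_cell x m : 0 <= x < 1 -> in_cell (code x m) x.
Proof.
move=> x01; elim: m => [|m IH]; first by rewrite in_cell_nil.
exact: next_letter_cell.
Qed.

Lemma words_cell_unit m w x : w \in words n m -> in_cell w x -> 0 <= x < 1.
Proof.
elim: m w => [|m IH] [|a w]; try by [rewrite in_cell_nil|move=> /words_size].
rewrite words_cons => /andP[wm am] /in_cell_tail h; apply: (IH w) => //.
by apply: h; rewrite (words_size wm).
Qed.

Lemma codeE m w x : w \in words n m -> in_cell w x -> code x m = w.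
Proof.
elim: m w => [|m IH] [|a w]; try by [|move=> /words_size].
rewrite words_cons => /andP[wm am] xa.
have xw : in_cell w x.
  by apply: in_cell_tail xa; rewrite (words_size wm).
rewrite /= (IH w)//; congr cons.
exact/(in_cell_inj _ xa)/next_letter_cell.
Qed.

Lemma next_letter_homo w x y : x <= y -> (next_letter w x <= next_letter w y)%N.
Proof.
move=> xy; apply: sub_find => a /=; exact: le_lt_trans.
Qed.

End interval_coding.

(** * Bounded random variables *)

Lemma half_power_lt (R : realType) (e : R) : 0 < e -> exists m, (2^-1 : R) ^+ m < e.
Proof.
move=> e0; have [m _ me] : \forall m \near \oo, (2^-1 : R) ^+ m < e.
  have /cvgr_lt : (2^-1 : R) ^+ m @[m --> \oo] --> 0.
    by apply: cvg_expr; rewrite ger0_norm ?invr_ge0// invf_lt1 ?ltr1n.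
  exact.
by exists m; exact: (me m (leqnn m)).
Qed.

Lemma dist_mul_le (R : realDomainType) (x y x' y' d : R) :
  0 <= x <= 1 -> 0 <= y' <= 1 -> `|x - x'| <= d -> `|y - y'| <= d ->
  `|x * y - x' * y'| <= d + d.
Proof.
move=> /andP[x0 x1] /andP[y0 y1] dx dy.
have -> : x * y - x' * y' = x * (y - y') + (x - x') * y' by ring.
rewrite (le_trans (ler_normD _ _))// !normrM (ger0_norm x0) (ger0_norm y0).
by apply: lerD; [apply: le_trans dy; exact: ler_piMl
                |apply: le_trans dx; exact: ler_piMr].
Qed.

Section bounded_integrals.
Context d (T : measurableType d) (R : realType) (P : probability T R).

Definition bounded_mfun (f : T -> R) :=
  measurable_fun setT f /\ exists M, forall t, `|f t| <= M.

Lemma bounded_mfun_integrable f : bounded_mfun f -> P.-integrable setT (EFin \o f).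
Proof.
move=> [mf [M fM]]; apply: measurable_bounded_integrable => //.
  by rewrite -ge0_fin_numE// fin_num_measure.
exists M; split; first exact: num_real.
by move=> N MN t _ /=; apply: le_trans (fM t) (ltW MN).
Qed.

(** Change of variables for a random variable with finitely many values: the
integral only sees the law [q] of [c]. *)
Lemma finite_valued_integral (I : eqType) (c : T -> I) (s : seq I) (F : I -> R)
    (q : I -> R) : uniq s -> (forall t, c t \in s) ->
  (forall w, measurable [set t | c t = w]) ->
  (forall w, w \in s -> P [set t | c t = w] = (q w)%:E) ->
  (\int[P]_t (F (c t))%:E = (\sum_(w <- s) q w * F w)%:E)%E.
Proof.
move=> us cs mc Pq.
rewrite (eq_integral (fun t => (\sum_(w <- s) (F w)%:E * (\1_[set t | c t = w] t)%:E)%E)); last first.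
  move=> t _; rewrite (bigD1_seq (c t))//= big1 ?adde0.
    by rewrite indicE mem_set ?mule1.
  move=> w; rewrite eq_sym => /eqP cw.
  by rewrite indicE memNset ?mule0.
rewrite integral_sum//; last first.
  by move=> w; apply: integrableZl => //; exact: integrable_indic.
rewrite -sumEFin big_seq [RHS]big_seq; apply: eq_bigr => w ws.
rewrite integralZl//; last exact: integrable_indic.
rewrite integral_indic// setIT [X in (_ * X)%E](_ : _ = (q w)%:E).
  by rewrite EFinM muleC.
exact: Pq.
Qed.

(** Closeness in measure controls integrals of functions with values in [0, 1]:
outside the bad event [B] the integrands differ by at most [e], and on [B] by
at most 1. *)
Lemma close_integral (f g : T -> R) (B : set T) (e b : R) :
  measurable_fun setT f -> measurable_fun setT g -> measurable B ->
  (forall t, 0 <= f t <= 1) -> (forall t, 0 <= g t <= 1) ->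
  (forall t, ~ B t -> `|f t - g t| <= e) -> 0 <= e -> (P B <= b%:E)%E ->
  `|\int[P]_t f t - \int[P]_t g t| <= e + b.
Proof.
move=> mf mg mB f01 g01 fge e0 Pb.
have bf : bounded_mfun f.
  by split=> //; exists 1 => t; have /andP[a c] := f01 t; rewrite ger0_norm.
have bg : bounded_mfun g.
  by split=> //; exists 1 => t; have /andP[a c] := g01 t; rewrite ger0_norm.
have If := bounded_mfun_integrable bf; have Ig := bounded_mfun_integrable bg.
rewrite -RintegralB//.
have Ifg : P.-integrable setT (EFin \o (fun t => f t - g t)).
  rewrite [X in P.-integrable _ X](_ : _ = (EFin \o f) \- (EFin \o g))%E//.
  exact: integrableB.
apply: le_trans (le_normr_Rintegral _ _) _ => //.
have bh : P.-integrable setT (EFin \o (fun t => e + \1_B t)).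
  apply: bounded_mfun_integrable; split; first exact: measurable_funD.
  exists (e + 1) => t; rewrite ger0_norm ?addr_ge0//.
  by rewrite lerD2l indicE lern1; case: (_ \in _).
apply: (@le_trans _ _ (\int[P]_t (e + \1_B t))).
  apply: le_Rintegral => //; first exact: integrable_norm.
  move=> t _; have [Bt|Bt] := pselect (B t); last first.
    by rewrite indicE memNset// addr0 fge.
  rewrite indicE mem_set//.
  have /andP[a c] := f01 t; have /andP[a' c'] := g01 t.
  by rewrite /= ler_norml; apply/andP; split; lra.
rewrite RintegralD//; last 2 first.
- by apply: bounded_mfun_integrable; split => //; exists `|e|.
- exact: integrable_indic.
rewrite Rintegral_cst// [X in _ * fine X](_ : _ = 1%E); last exact: probability_setT.
rewrite mulr1 lerD2l.
rewrite /Rintegral integral_indic// setIT.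
by rewrite -lee_fin fineK// fin_num_measure.
Qed.

End bounded_integrals.

(** * Digits of a uniform point *)

Lemma measurable_fun_nat d (T : measurableType d) (f : T -> nat) :
  (forall a, measurable (f @^-1` [set a])) -> measurable_fun setT f.
Proof.
move=> mf _ A _; rewrite setTI.
rewrite (_ : f @^-1` A = \bigcup_(a in A) (f @^-1` [set a])).
  exact: bigcup_measurable.
by apply/seteqP; split => [x Ax|x [a Aa /= ->]]//; exists (f x).
Qed.

Lemma countable_measurable_fibers d (T : measurableType d) (I : countType)
    (f : T -> I) (A : set I) :
  (forall i, measurable [set t | f t = i]) -> measurable (f @^-1` A).
Proof.
move=> mf.
rewrite (_ : f @^-1` A = \bigcup_i ([set t | f t = i] `&` [set t | A i])).
  apply: countable_bigcupT_measurable => // i; apply: measurableI; first exact: mf.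
  have [Ai|nAi] := pselect (A i).
    by rewrite (_ : [set _ | _] = setT)//; apply/seteqP; split.
  by rewrite (_ : [set _ | _] = set0)//; apply/seteqP; split.
by apply/seteqP; split => [t At|t [i _ [/= -> //]]]; exists (f t).
Qed.

Section uniform_law.
Variable R : realType.

Definition unif : probability (measurableTypeR R) R := uniform_prob (@ltr01 R).

Lemma unifE A : measurable A -> unif A = lebesgue_measure (A `&` `[0, 1]).
Proof.
move=> mA; rewrite /unif /= /uniform_prob integral_uniform_pdf.
rewrite (eq_integral (fun=> 1%:E)); last first.
  by move=> x; rewrite inE /= in_itv /= => -[_ x01]; rewrite /uniform_pdf x01 subr0 invr1.
by rewrite integral_cst ?mul1e//; exact: measurableI.
Qed.

Lemma unif_itv (a b : R) : 0 <= a -> a <= b -> b <= 1 ->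
  unif `[a, b[%classic = (b - a)%:E.
Proof.
move=> a0 ab b1; rewrite unifE// setIidl; last first.
  by move=> x /=; rewrite !in_itv /= => /andP[? ?]; apply/andP; split; lra.
rewrite lebesgue_measure_itv /= lte_fin; case: ltP => // ba.
by have -> : b = a by [lra]; rewrite subrr.
Qed.

Definition co01 : set (measurableTypeR R) := `[0, 1[%classic.

Lemma measurable_co01 : measurable co01.
Proof. exact: measurable_itv. Qed.

Lemma unif_setI_co01 A : measurable A -> unif (A `&` co01) = unif A.
Proof.
move=> mA; have mI := measurable_co01.
have mC : measurable (A `&` ~` co01) by apply: measurableI => //; exact: measurableC.
rewrite -[in RHS](setIT A) -(setvU co01) setUC setIUr measureU//; last 2 first.
- exact: measurableI.
- by rewrite setIACA setICr setI0.
rewrite [X in (_ + X)%E](_ : _ = 0%E) ?adde0//.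
have : (unif (~` co01) <= 0)%E.
  by rewrite probability_setC// /co01 unif_itv ?subr0 ?subee.
move=> h; apply/eqP; rewrite eq_le measure_ge0 andbT; apply: le_trans h.
by apply: le_measure; rewrite ?inE//; exact: measurableC.
Qed.

End uniform_law.

Section coding_law.
Variables (R : realType) (n : nat -> nat) (p : seq nat -> R).
Hypothesis n_gt0 : forall j, (0 < n j)%N.
Hypothesis p_ge0 : forall w, 0 <= p w.
Hypothesis p_nil : p [::] = 1.
Hypothesis p_split : forall w, p w = \sum_(a < n (size w)) p (nat_of_ord a :: w).

Local Notation mR := (measurableTypeR R).

Lemma measurable_next_letter w :
  measurable_fun (setT : set mR) (next_letter n p w).
Proof.
apply: measurable_fun_nat => a; apply: is_interval_measurable => x y /= xa ya z.
move=> /andP[xz zy]; apply/eqP; rewrite eqn_leq.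
have := next_letter_homo n p w xz; rewrite xa => ->.
by have := next_letter_homo n p w zy; rewrite ya => ->.
Qed.

Lemma measurable_code m w : measurable [set x : mR | code n p x m = w].
Proof.
elim: m w => [|m IH] [|a w] /=.
- by rewrite (_ : [set _ | _] = setT)//; apply/seteqP; split.
- by rewrite (_ : [set _ | _] = set0)//; apply/seteqP; split.
- by rewrite (_ : [set _ | _] = set0)//; apply/seteqP; split.
rewrite (_ : [set _ | _] =
  [set x | code n p x m = w] `&` (next_letter n p w @^-1` [set a])).
  apply: measurableI; first exact: IH.
  by rewrite -[X in measurable X]setTI; exact: measurable_next_letter.
by apply/seteqP; split => x /= [] => [<- <-|-> ->].
Qed.

Lemma measurable_digits j : measurable_fun (setT : set mR) (digits n p ^~ j).
Proof.
apply: measurable_fun_nat => a.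
rewrite (_ : _ @^-1` _ =
    (fun x => code n p x j.+1) @^-1` [set w | head 0%N w = a]).
  by apply: countable_measurable_fibers; exact: measurable_code.
by apply/seteqP; split.
Qed.

(** The points whose digits start with [w] are those of the cell of [w]; only
the points of [0, 1) count, the others receive arbitrary digits. *)
Lemma unif_code m w : w \in words n m ->
  unif R [set x | code n p x m = w] = (p w)%:E.
Proof.
move=> wm; rewrite -unif_setI_co01; last exact: measurable_code.
rewrite (_ : _ `&` _ = `[left_end p w, left_end p w + p w[%classic); last first.
  apply/seteqP; split => x /=; rewrite !in_itv /=.
    by move=> [<- x01]; exact: code_cell.
  move=> xw; split; first exact: (codeE n_gt0 p_ge0 p_split wm).
  exact: (words_cell_unit p_ge0 p_nil p_split wm).
rewrite unif_itv ?left_end_ge0//; last 2 first.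
- by rewrite lerDl.
- elim: m w wm => [|m IH] [|a w]; try by move=> /words_size.
    by rewrite /= add0r p_nil.
  rewrite words_cons => /andP[wm am].
  rewrite -right_endS (le_trans _ (IH _ wm))//.
  rewrite -(left_end_full p_split) left_end_mono// (words_size wm)//.
by rewrite addrAC subrr add0r.
Qed.

Lemma code_integral m F :
  (\int[unif R]_x (F (code n p x m))%:E =
   (\sum_(w <- words n m) p w * F w)%:E)%E.
Proof.
apply: finite_valued_integral.
- exact: words_uniq.
- by move=> x; exact: code_in_words.
- exact: measurable_code.
- exact: unif_code.
Qed.

End coding_law.

(** * The space of letter sequences *)

(** Generators of the product sigma-algebra on the sequences of letters. *)
Definition coordinate_sets : set (set (nat -> nat)) :=
  [set A | exists j a, A = [set w | w j = a]].

Definition seqspace := g_sigma_algebraType coordinate_sets.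

Definition cylinder (m : nat) (Q : pred (seq nat)) : set seqspace :=
  [set w | Q (prefix_word w m)].

Lemma measurable_coordinate j :
  measurable_fun (setT : set seqspace) (fun w : seqspace => w j).
Proof.
by apply: measurable_fun_nat => a; apply: sub_sigma_algebra; exists j, a.
Qed.

Lemma measurable_to_seqspace d (T : measurableType d) (f : T -> seqspace) :
  (forall j, measurable_fun setT (fun t => f t j)) -> measurable_fun setT f.
Proof.
move=> mf; apply: (@measurability _ _ T seqspace setT f coordinate_sets) => //.
move=> _ [_ [j [a ->]] <-].
by apply: (mf j measurableT [set a]).
Qed.

Lemma measurable_prefix m v :
  measurable [set w : seqspace | prefix_word w m = v].
Proof.
elim: m v => [|m IH] [|a v] /=.
- by rewrite (_ : [set _ | _] = setT)//; apply/seteqP; split.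
- by rewrite (_ : [set _ | _] = set0)//; apply/seteqP; split.
- by rewrite (_ : [set _ | _] = set0)//; apply/seteqP; split.
rewrite (_ : [set _ | _] =
  [set w : seqspace | prefix_word w m = v] `&` ((fun w : seqspace => w m) @^-1` [set a])).
  apply: measurableI; first exact: IH.
  by rewrite -[X in measurable X]setTI; exact: measurable_coordinate.
by apply/seteqP; split => x /= [] => [<- <-|-> ->].
Qed.

Lemma measurable_cylinder m Q : measurable (cylinder m Q).
Proof.
by apply: (@countable_measurable_fibers _ _ _ _ (fun v => Q v)); exact: measurable_prefix.
Qed.

Lemma measurable_word_fun (R : realType) m (F : seq nat -> R) :
  measurable_fun setT (fun w : seqspace => F (prefix_word w m)).
Proof.
move=> _ A mA; rewrite setTI.
by apply: (@countable_measurable_fibers _ _ _ _ (F @^-1` A)); exact: measurable_prefix.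
Qed.

(** A condition on a prefix is a condition on any longer prefix; this is how
finitely many cylinders are brought to a common level. *)
Lemma cylinder_raise m m' Q : (m <= m')%N ->
  cylinder m Q = cylinder m' (fun v => Q (drop (m' - m) v)).
Proof.
move=> mm'; apply/seteqP.
by split=> w /=; rewrite /cylinder /= drop_prefix_word.
Qed.

Lemma cvg_near_lte (R : realType) (I : Type) (F : set_system I) (FF : Filter F)
    (u : I -> \bar R) (x y : \bar R) :
  (u @ F --> x)%E -> (x < y)%E -> \forall i \near F, (u i < y)%E.
Proof.
by move=> ux xy; apply: (ux [set z | (z < y)%E]); exact: open_ereal_lt'.
Qed.

Section cylinder_approximation.
Variables (R : realType) (mu : {measure set seqspace -> \bar R}).
Hypothesis mu_fin : (mu setT < +oo)%E.

Definition cylinder_approximable (A : set seqspace) :=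
  measurable A /\ forall e : R, 0 < e -> exists m Q,
    (mu ((A `\` cylinder m Q) `|` (cylinder m Q `\` A)) < e%:E)%E.

Let mu_lt (A B : set seqspace) (e : \bar R) : measurable A -> measurable B ->
  A `<=` B -> (mu B < e)%E -> (mu A < e)%E.
Proof. by move=> mA mB AB; apply: le_lt_trans; apply: le_measure; rewrite ?inE. Qed.

Lemma cylinder_approximableC A :
  cylinder_approximable A -> cylinder_approximable (~` A).
Proof.
move=> [mA apA]; split=> [|e e0]; first exact: measurableC.
have [m [Q mQ]] := apA e e0; exists m, (fun v => ~~ Q v).
rewrite (_ : cylinder m _ = ~` cylinder m Q); last first.
  by apply/seteqP; split => w /=; [move/negP|move/negP].
by rewrite !setDE !setCK setUC (setIC _ A) [X in _ `|` X]setIC.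
Qed.

Lemma cylinder_approximableU A B : cylinder_approximable A ->
  cylinder_approximable B -> cylinder_approximable (A `|` B).
Proof.
move=> [mA apA] [mB apB]; split=> [|e e0]; first exact: measurableU.
have e20 : 0 < e / 2 by rewrite divr_gt0.
have [mA' [QA hA]] := apA _ e20; have [mB' [QB hB]] := apB _ e20.
pose M := maxn mA' mB'.
pose Q1 (v : seq nat) := QA (drop (M - mA') v).
pose Q2 (v : seq nat) := QB (drop (M - mB') v).
rewrite (cylinder_raise QA (leq_maxl mA' mB')) -/M -/Q1 in hA.
rewrite (cylinder_raise QB (leq_maxr mA' mB')) -/M -/Q2 in hB.
exists M, (fun v => Q1 v || Q2 v).
set DA := (X in mu X) in hA; set DB := (X in mu X) in hB.
have mC m Q := measurable_cylinder m Q.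
have mDA : measurable DA by apply: measurableU; exact: measurableD.
have mDB : measurable DB by apply: measurableU; exact: measurableD.
apply: (@mu_lt _ (DA `|` DB)).
- by apply: measurableU; apply: measurableD => //; exact: measurableU.
- exact: measurableU.
- move=> w [[[Aw|Bw] /negP]|[/orP[q|q] /not_orP[nA nB]]].
  + by rewrite negb_or => /andP[/negP q _]; left; left.
  + by rewrite negb_or => /andP[_ /negP q]; right; left.
  + by left; right.
  + by right; right.
apply: (le_lt_trans (measureU2 _ _ _)) => //.
by rewrite (splitr e) EFinD lteD.
Qed.

Lemma cylinder_approximable0 : cylinder_approximable set0.
Proof.
split=> // e e0; exists 0%N, xpred0.
rewrite (_ : cylinder _ _ = set0) ?setDv ?setU0 ?measure0//.
by apply/seteqP; split.
Qed.

(** A countable union is approximated by a finite one because the measure is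
finite, and finite unions of approximable sets are approximable. *)
Lemma cylinder_approximable_bigcup (A : (set seqspace)^nat) :
  (forall k, cylinder_approximable (A k)) ->
  cylinder_approximable (\bigcup_k A k).
Proof.
move=> apA; have mA k : measurable (A k) by case: (apA k).
have mU : measurable (\bigcup_k A k) by exact: bigcupT_measurable.
split=> // e e0.
pose F N := \big[setU/set0]_(k < N) A k.
have mF N : measurable (F N) by exact: bigsetU_measurable.
pose D N := (\bigcup_k A k) `\` F N.
have mD N : measurable (D N) by exact: measurableD.
have capD : \bigcap_N D N = set0.
  apply/seteqP; split => // w Dw; have [[k _ Akw] _] := Dw 0%N Logic.I.
  have [_ /(_ _)] := Dw k.+1 Logic.I; apply.
  by rewrite /F -bigcup_mkord; exists k => //=.
have cvD : mu \o D @ \oo --> (0%E : \bar R).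
  rewrite -(measure0 mu) -capD; apply: nonincreasing_cvg_mu => //.
  - apply: le_lt_trans mu_fin; apply: le_measure; rewrite ?inE//.
  - by rewrite capD.
  - move=> N M NM; apply/subsetPset => w [Uw nFw]; split => //; apply: contra_not nFw.
    by rewrite /F -!bigcup_mkord => -[k /= kN Akw]; exists k => //=; exact: leq_trans NM.
have e20 : 0 < e / 2 by rewrite divr_gt0.
have [N hN] : exists N, (mu (D N) < (e / 2)%:E)%E.
  have : \forall N \near \oo, (mu (D N) < (e / 2)%:E)%E.
    by apply: (@cvg_near_lte R nat \oo _ (mu \o D) 0%E _ cvD); rewrite lte_fin.
  by case=> N _ /(_ N (leqnn N)); exists N.
have apF : cylinder_approximable (F N).
  rewrite /F; elim: N {hN} => [|N IH]; first by rewrite big_ord0; exact: cylinder_approximable0.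
  by rewrite big_ord_recr; exact: cylinder_approximableU.
have [_ /(_ _ e20) [m [Q hQ]]] := apF; exists m, Q.
have mC := measurable_cylinder m Q.
set DF := (X in mu X) in hQ.
have mDF : measurable DF by apply: measurableU; exact: measurableD.
apply: (@mu_lt _ (D N `|` DF)).
- by apply: measurableU; exact: measurableD.
- exact: measurableU.
- move=> w [[Uw nQ]|[Qw nU]].
    have [Fw|nFw] := pselect (F N w); last by left.
    by right; left.
  right; right; split=> // Fw; apply: nU.
  by move: Fw; rewrite /F -bigcup_mkord => -[k _ Akw]; exists k.
apply: (le_lt_trans (measureU2 _ _ _)) => //.
by rewrite (splitr e) EFinD lteD.
Qed.

(** The approximable sets form a sigma-algebra that contains the generators. *)
Lemma measurable_cylinder_approximable A :
  measurable A -> cylinder_approximable A.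
Proof.
move: A; apply: smallest_sub.
  split.
  - exact: cylinder_approximable0.
  - by move=> A apA; rewrite setTD; exact: cylinder_approximableC.
  - exact: cylinder_approximable_bigcup.
move=> _ [j [a ->]]; split=> [|e e0].
  by have := @measurable_coordinate j measurableT [set a]; rewrite setTI; apply.
pose Q (v : seq nat) := head 0%N v == a; exists j.+1, Q.
have -> : [set w : nat -> nat | w j = a] = cylinder j.+1 Q.
  by apply/seteqP; split => w /= /eqP.
by rewrite setDv setU0 measure0.
Qed.

End cylinder_approximation.

(** * Approximation by functions of a finite prefix *)

(** Rounding [t] by counting the integer levels below it; this turns the
approximation of functions into that of their level sets. *)
Lemma count_levels (R : realFieldType) (t : R) N : 0 <= t <= N%:R ->
  `|t - \sum_(c < N) (c.+1%:R <= t)%R%:R| <= 1.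
Proof.
elim: N => [|N IH]; first by rewrite big_ord0 subr0 => t0; rewrite ger0_norm; lra.
rewrite big_ord_recr /= -natr1 => /andP[t0 tN].
have [tN'|tN'] := leP t N%:R.
  by rewrite (_ : (_ <= t) = false) ?addr0 ?IH ?t0//; apply/negbTE; rewrite -ltNge; lra.
rewrite (eq_bigr (fun=> 1)) => [|c _].
  rewrite sumr_const card_ord; case: (_ <= t) => /=; rewrite ler_norml; apply/andP; split; lra.
rewrite (_ : (_ <= t) = true)//.
by apply: le_trans (ltW tN'); rewrite ler_nat.
Qed.

Section word_approximation.
Variables (R : realType) (mu : {measure set seqspace -> \bar R}).
Hypothesis mu_fin : (mu setT < +oo)%E.

Lemma approximate_sets (I : choiceType) (A : I -> set seqspace) (s : seq I) (e : R) :
  (forall i, measurable (A i)) -> 0 < e ->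
  exists m (Q : I -> pred (seq nat)) (B : set seqspace),
  [/\ measurable B, (mu B < e%:E)%E & forall i w, i \in s -> ~ B w ->
      (w \in A i) = Q i (prefix_word w m)].
Proof.
move=> mA; elim: s e => [|i s IH] e e0.
  by exists 0%N, (fun _ _ => true), set0; split; rewrite ?measure0.
have e20 : 0 < e / 2 by rewrite divr_gt0.
have [m [Q [B [mB Be QA]]]] := IH _ e20.
have [_ /(_ _ e20) [m' [Q' Q'e]]] := measurable_cylinder_approximable mu_fin (mA i).
set B' := (X in mu X) in Q'e.
have mB' : measurable B'.
  by apply: measurableU; apply: measurableD => //; exact: measurable_cylinder.
pose M := maxn m m'.
exists M, (fun j => if j == i then fun v => Q' (drop (M - m') v) else fun v => Q j (drop (M - m) v)).
exists (B `|` B'); split.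
- exact: measurableU.
- apply: (le_lt_trans (measureU2 _ _ _)) => //.
  by rewrite (splitr e) EFinD lteD.
move=> j w js /not_orP[nB nB'].
have [ji|ji] := eqVneq j i; last first.
  rewrite drop_prefix_word ?leq_maxl// QA//.
  by move: js; rewrite inE (negbTE ji).
rewrite drop_prefix_word ?leq_maxr// ji.
apply/idP/idP => [/set_mem Aw|Qw].
  by apply: contrapT => nQ; apply: nB'; left.
apply/mem_set; apply: contrapT => nA; apply: nB'; by right.
Qed.

Lemma approximate_functions k (G : 'I_k -> seqspace -> R) (e : R) :
  (forall i, measurable_fun setT (G i)) -> (forall i w, 0 <= G i w <= 1) -> 0 < e ->
  exists m (F : 'I_k -> seq nat -> R) (B : set seqspace),
  [/\ measurable B, (mu B < e%:E)%E, forall i v, 0 <= F i v <= 1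
    & forall i w, ~ B w -> `|G i w - F i (prefix_word w m)| <= e].
Proof.
move=> mG G01 e0.
pose N := (Num.truncn e^-1).+1.
have N0 : (0 : R) < N%:R by rewrite ltr0n.
have Ne : (N%:R : R)^-1 <= e.
  rewrite -[leRHS]invrK lef_pV2 ?posrE ?invr_gt0//.
  by apply: ltW; rewrite truncnS_gt.
pose A (ic : 'I_k * 'I_N) : set seqspace := [set w | ic.2.+1%:R <= N%:R * G ic.1 w].
have mA ic : measurable (A ic).
  rewrite (_ : A ic = (fun w => N%:R * G ic.1 w) @^-1` `[ic.2.+1%:R, +oo[%classic).
    rewrite -[X in measurable X]setTI.
    by apply: measurable_funM => //; exact: measurable_cst.
  by apply/seteqP; split => w /=; rewrite in_itv /= andbT.
have [m [Q [B [mB Be QA]]]] := approximate_sets (enum {: 'I_k * 'I_N}) mA e0.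
exists m, (fun i v => N%:R^-1 * \sum_(c < N) (Q (i, c) v)%:R), B; split=> //.
- move=> i v; apply/andP; split; first by rewrite mulr_ge0 ?invr_ge0 ?sumr_ge0 ?ltW.
  rewrite ler_pdivrMl// mulr1 -[leRHS](_ : \sum_(c < N) 1 = N%:R); last first.
    by rewrite sumr_const card_ord.
  by apply: ler_sum => c _; rewrite lern1; case: (Q _ _).
- move=> i w nB; apply: le_trans Ne.
  rewrite (eq_bigr (fun c : 'I_N => (c.+1%:R <= N%:R * G i w)%R%:R)) => [|c _]; last first.
    rewrite -QA ?mem_enum//; congr (nat_of_bool _)%:R.
    by apply/idP/idP; rewrite inE.
  have /andP[G0 G1] := G01 i w.
  have /(@count_levels _ (N%:R * G i w) N) h : 0 <= N%:R * G i w <= N%:R.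
    by rewrite (mulr_ge0 (ltW N0) G0) (ler_piMr (ltW N0) G1).
  rewrite -(ler_pM2l N0) divff ?gt_eqF//.
  by rewrite -{1}(ger0_norm (ltW N0)) -normrM mulrBr mulrA divff ?gt_eqF// mul1r.
Qed.

(** After approximating each [G i] separately, the approximations are made to
sum to 1: a deficit is shared equally, an excess is divided out. Either change
is at most the error of the sum, hence the choice of [d] below. *)
Lemma approximate_partition k (G : 'I_k -> seqspace -> R) (e : R) : (0 < k)%N ->
  (forall i, measurable_fun setT (G i)) -> (forall i w, 0 <= G i w <= 1) -> 0 < e ->
  exists m (F : 'I_k -> seq nat -> R) (B : set seqspace),
  [/\ measurable B, (mu B < e%:E)%E, forall i v, 0 <= F i v,
      forall v, \sum_i F i v = 1
    & forall i w, \sum_i G i w = 1 -> ~ B w -> `|G i w - F i (prefix_word w m)| <= e].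
Proof.
move=> k0 mG G01 e0.
have k0R : (0 : R) < k%:R by rewrite ltr0n.
pose d := e / k.+1%:R.
have d0 : 0 < d by rewrite divr_gt0.
have de : d <= e by rewrite ler_pdivrMr// ler_peMr ?ler1n// ltW.
have [m [F [B [mB Be F01 GF]]]] := approximate_functions mG G01 d0.
pose s v := \sum_i F i v.
have s0 v : 0 <= s v by apply: sumr_ge0 => i _; have /andP[] := F01 i v.
pose F' i v := if s v <= 1 then F i v + (1 - s v) / k%:R else F i v / s v.
exists m, F', B; split => //.
- by apply: lt_le_trans Be _; rewrite lee_fin.
- move=> i v; have /andP[F0 _] := F01 i v; rewrite /F'.
  by case: ifP => s1; rewrite ?addr_ge0 ?divr_ge0// subr_ge0.
- move=> v; rewrite /F'; case s1: (s v <= 1).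
    rewrite big_split /= sumr_const card_ord -[X in _ + X]mulr_natr divfK ?gt_eqF//.
    by rewrite -/(s v) addrC subrK.
  by rewrite -mulr_suml divff// gt_eqF// (lt_trans ltr01)// ltNge s1.
move=> i w G1 nB; set v := prefix_word w m.
have sd : `|1 - s v| <= k%:R * d.
  rewrite -[X in X - _]G1 -sumrB (le_trans (ler_norm_sum _ _ _))//.
  have -> : k%:R * d = \sum_(j < k) d by rewrite sumr_const card_ord mulr_natl.
  by apply: ler_sum => j _; exact: GF.
have FF' : `|F i v - F' i v| <= k%:R * d.
  apply: le_trans sd; rewrite /F'; have /andP[F0 F1] := F01 i v.
  case: ifP => s1.
    rewrite opprD addrA subrr add0r normrN normrM [`|k%:R^-1|]ger0_norm ?invr_ge0//.
    by rewrite ler_piMr// invf_le1 ?ler1n.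
  have {}s1 : 1 < s v by rewrite ltNge s1.
  have s_gt0 : 0 < s v by exact: lt_trans s1.
  have -> : F i v - F i v / s v = F i v / s v * (s v - 1).
    by rewrite mulrBr mulr1 divfK ?gt_eqF.
  rewrite normrM (distrC (s v)) ler_piMl// ger0_norm ?divr_ge0//.
  by rewrite ler_pdivrMr// mul1r (le_trans F1)// ltW.
have -> : G i w - F' i v = (G i w - F i v) + (F i v - F' i v) by rewrite addrA subrK.
rewrite (le_trans (ler_normD _ _))// (le_trans (lerD (GF i w nB) FF'))//.
by rewrite -[X in X + _]mul1r -mulrDl nat1r /d mulrCA divff ?mulr1// pnatr_eq0.
Qed.

End word_approximation.

(** * Reading a point off its letters *)

Section coding_value.
Variables (R : realType) (n : nat -> nat) (p : seq nat -> R).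
Hypothesis n_gt0 : forall j, (0 < n j)%N.
Hypothesis p_ge0 : forall w, 0 <= p w.
Hypothesis p_nil : p [::] = 1.
Hypothesis p_split : forall w, p w = \sum_(a < n (size w)) p (nat_of_ord a :: w).

(** When the letters are admissible, this point lies in the closure of the cell of
every prefix. The minimum
with 1 makes the supremum that of a bounded set for every sequence, so that
[value] is measurable on the whole sequence space. *)
Definition value (w : nat -> nat) : R :=
  sups (fun m => Num.min 1 (left_end p (prefix_word w m))) 0.

Lemma measurable_value : measurable_fun setT (value : seqspace -> R).
Proof.
apply: measurable_fun_sups => [w _|m].
  by exists 1 => _ [m _ <-]; rewrite ge_min lexx.
exact: (@measurable_word_fun R m (fun v => Num.min 1 (left_end p v))).
Qed.

Section admissible.
Variable w : nat -> nat.
Hypothesis w_lt : forall j, (w j < n j)%N.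

Lemma left_end_prefix m k :
  left_end p (prefix_word w m) <= left_end p (prefix_word w (k + m)).
Proof. by elim: k => [//|k IH] /=; rewrite (le_trans IH)// lerDl sumr_ge0. Qed.

Lemma right_end_prefix m k :
  left_end p (prefix_word w (k + m)) + p (prefix_word w (k + m)) <=
  left_end p (prefix_word w m) + p (prefix_word w m).
Proof.
elim: k => [//|k IH]; rewrite addSn [prefix_word w _.+1]/= -right_endS.
apply: le_trans IH; rewrite -(left_end_full p_split) left_end_mono//.
by rewrite size_prefix_word.
Qed.

Lemma value_bounds m : left_end p (prefix_word w m) <= value w
  <= left_end p (prefix_word w m) + p (prefix_word w m).
Proof.
have le1 k : left_end p (prefix_word w k) <= 1.
  have := right_end_prefix 0 k; rewrite addn0 /= add0r p_nil.
  by apply: le_trans; rewrite lerDl.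
have vE : value w = sup (range (fun m => left_end p (prefix_word w m))).
  rewrite /value /sups; congr sup; apply/seteqP; split => _ [k _ <-]; exists k => //.
    by rewrite min_r.
  by rewrite min_r.
rewrite vE; apply/andP; split.
  apply: ub_le_sup; last by exists m.
  by exists 1 => _ [k _ <-].
apply: ge_sup; first by exists (left_end p (prefix_word w 0)), 0%N.
move=> _ [k _ <-]; have [km|/ltnW mk] := leqP k m.
  rewrite -(subnK km) (le_trans (left_end_prefix k (m - k)))//.
  by rewrite lerDl.
by rewrite -(subnK mk) (le_trans _ (right_end_prefix m (k - m)))// lerDl.
Qed.

End admissible.

Lemma value_digits x : (forall e, 0 < e -> exists m, forall w, size w = m -> p w <= e) ->
  0 <= x < 1 -> value (digits n p x) = x.
Proof.
move=> p0 x01; apply/eqP; rewrite -subr_eq0 -normr_le0; apply/ler_addgt0Pl => e e0.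
have [m pe] := p0 e e0; rewrite addr0.
have := value_bounds (digits_lt p n_gt0 x) m; rewrite prefix_digits.
have := code_cell n_gt0 p_nil p_split m x01; rewrite /in_cell.
have := pe _ (size_code n p x m).
set l := left_end _ _; set q := p _; set v := value _.
by move=> qe /andP[h1 h2] /andP[h3 h4]; rewrite ler_norml; apply/andP; split; lra.
Qed.

(** The cells are half-open, so the limit point of nested cells could be their
common right end. A sequence that never uses the last letter avoids this. *)
Lemma value_cell w m : (forall v, 0 < p v) -> (forall j, ((w j).+1 < n j)%N) ->
  in_cell p (prefix_word w m) (value w).
Proof.
move=> p_gt0 wn; have w_lt j : (w j < n j)%N := ltnW (wn j).
have /andP[l _] := value_bounds w_lt m; rewrite /in_cell l /=.
have /andP[_ r] := value_bounds w_lt m.+1; apply: le_lt_trans r _.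
rewrite [prefix_word w _.+1]/= -right_endS -(left_end_full p_split) size_prefix_word.
apply: lt_le_trans (left_end_mono p_ge0 _ (wn m)).
by rewrite [ltRHS]right_endS ltrDl.
Qed.

Lemma digits_value w : (forall v, 0 < p v) -> (forall j, ((w j).+1 < n j)%N) ->
  digits n p (value w) = w.
Proof.
move=> p_gt0 wn; have w_lt j : (w j < n j)%N := ltnW (wn j).
apply/funext => j.
have := codeE n_gt0 p_ge0 p_split (prefix_word_in j.+1 w_lt) (value_cell j.+1 p_gt0 wn).
by move=> /(congr1 (head 0%N)).
Qed.

End coding_value.

(** * A null set containing a copy of the sequence space *)

Section sparse_coding.
Variables (R : realType) (n : nat -> nat).
Hypothesis n_gt0 : forall j, (0 < n j)%N.

(** With twice as many equally likely letters, the sequences that use only the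
first half of the letters are still all the sequences of interest, but each
letter halves the measure of the points coding them. *)
Definition double_sizes (j : nat) := (n j).*2.

Fixpoint sparse_weight (w : seq nat) : R :=
  if w is _ :: w' then sparse_weight w' / (double_sizes (size w'))%:R else 1.

Definition sparse_digits (x : R) := digits double_sizes sparse_weight x.

Definition sparse_value (w : nat -> nat) : R := value sparse_weight w.

Definition sparse_set : set (measurableTypeR R) :=
  [set x | 0 <= x < 1 /\ forall j, (sparse_digits x j < n j)%N].

Lemma double_sizes_gt0 j : (0 < double_sizes j)%N.
Proof. by rewrite double_gt0. Qed.

Lemma sparse_weight_gt0 w : 0 < sparse_weight w.
Proof. by elim: w => //= a w IH; rewrite divr_gt0// ltr0n double_sizes_gt0. Qed.

Lemma sparse_weight_split w :
  sparse_weight w = \sum_(a < double_sizes (size w)) sparse_weight (nat_of_ord a :: w).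
Proof.
rewrite /= sumr_const card_ord -[RHS]mulr_natr divfK//.
by rewrite pnatr_eq0 -lt0n double_sizes_gt0.
Qed.

Let weight_ge0 w : 0 <= sparse_weight w.
Proof. exact/ltW/sparse_weight_gt0. Qed.

Lemma sparse_weight_words m :
  \sum_(w <- words double_sizes m) sparse_weight w * (w \in words n m)%:R = 2^-1 ^+ m.
Proof.
elim: m => [|m IH]; first by rewrite big_seq1 mul1r.
rewrite sum_words_recr exprSr -IH mulr_suml big_seq [RHS]big_seq.
apply: eq_bigr => w /words_size sw.
under eq_bigr => a _ do rewrite words_cons /= sw -mulnb natrM mulrA.
rewrite -mulr_sumr mulrAC.
have -> : \sum_(a < double_sizes m) (a < n m)%N%:R = (n m)%:R :> R.
  rewrite -natr_sum; congr _%:R.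
  transitivity (\sum_(a < double_sizes m | (a < n m)%N) 1)%N.
    by rewrite [RHS]big_mkcond; apply: eq_bigr => a _; case: (_ < _)%N.
  rewrite -(big_ord_widen _ (fun=> 1%N)) ?sum1_card ?card_ord//.
  by rewrite /double_sizes -addnn leq_addr.
rewrite /double_sizes -muln2 natrM.
have : (n m)%:R != 0 :> R by rewrite pnatr_eq0 -lt0n.
by move=> n0; field.
Qed.

Lemma measurable_sparse_set : measurable sparse_set.
Proof.
rewrite (_ : sparse_set = @co01 R `&`
    \bigcap_j ((digits double_sizes sparse_weight)^~ j @^-1` [set a | (a < n j)%N])).
  apply: measurableI; first exact: measurable_co01.
  apply: bigcapT_measurable => j; rewrite -[X in measurable X]setTI.
  exact: measurable_digits.
apply/seteqP; split => x [x01 xn]; split.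
- by rewrite /co01 /= in_itv.
- by move=> j _; exact: xn.
- by move: x01; rewrite /co01 /= in_itv.
- by move=> j; exact: xn.
Qed.

Lemma unif_sparse_set : unif R sparse_set = 0%E.
Proof.
apply/eqP; rewrite eq_le measure_ge0 andbT.
suff bound m : (unif R sparse_set <= (2^-1 ^+ m)%:E)%E.
  apply/lee_addgt0Pr => e e0; rewrite add0e.
  have [m me] := half_power_lt e0.
  by apply: le_trans (bound m) _; rewrite lee_fin ltW.
pose A := [set x : measurableTypeR R | code double_sizes sparse_weight x m \in words n m].
have mA : measurable A.
  apply: (@countable_measurable_fibers _ _ _ (fun x => code double_sizes sparse_weight x m)
    [set w | w \in words n m]).
  exact: measurable_code.
apply: (@le_trans _ _ (unif R A)).
  apply: le_measure; rewrite ?inE//; first exact: measurable_sparse_set.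
  by move=> x [_ xn]; rewrite /A /= -prefix_digits; exact: prefix_word_in.
rewrite -sparse_weight_words -(code_integral double_sizes_gt0)//.
- rewrite (eq_integral (fun x => (\1_A x)%:E)) ?integral_indic ?setIT// => x _.
  rewrite indicE; congr (nat_of_bool _)%:R%:E; apply/idP/idP.
    by move=> h; rewrite inE.
  by rewrite inE.
- exact: sparse_weight_split.
Qed.

End sparse_coding.

(** * Embedding letter sequences into the unit interval *)

Section embedding.
Variables (R : realType) (n : nat -> nat) (p : seq nat -> R).
Hypothesis n_gt0 : forall j, (0 < n j)%N.
Hypothesis p_ge0 : forall w, 0 <= p w.
Hypothesis p_nil : p [::] = 1.
Hypothesis p_split : forall w, p w = \sum_(a < n (size w)) p (nat_of_ord a :: w).
Hypothesis p_small : forall e, 0 < e -> exists m, forall w, size w = m -> p w <= e.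

Local Notation mR := (measurableTypeR R).

(** The sequences that the interval coding recovers from their value, and whose
value does not interfere with the copies placed in the null set. *)
Definition regular_seq : set seqspace :=
  [set w | 0 <= value p w < 1 /\ ~ sparse_set n (value p w) /\
           digits n p (value p w) = w].

(** The interval coding where it is faithful, and the null copy of the sequence
space elsewhere. The latter absorbs the sequences that are negligible for the
law of a random vertex but may be charged by the law of a random edge. *)
Definition encode (w : seqspace) : R :=
  if w \in regular_seq then value p w else sparse_value R n w.

Definition decode (x : mR) : seqspace :=
  if x \in sparse_set n then sparse_digits n x else digits n p x.

Let weight_ge0 w : 0 <= sparse_weight R n w.
Proof. exact/ltW/sparse_weight_gt0. Qed.

Lemma succ_double_sizes a j : (a < n j)%N -> (a.+1 < double_sizes n j)%N.
Proof.
move=> an; rewrite /double_sizes -addnn -addn1.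
by apply: leq_add => //; exact: leq_trans an.
Qed.

Lemma sparse_digits_value w : (forall j, (w j < n j)%N) ->
  sparse_digits n (sparse_value R n w) = w.
Proof.
move=> wn; apply: digits_value => //.
- by move=> j; exact: double_sizes_gt0.
- exact: sparse_weight_split.
- exact: sparse_weight_gt0.
- by move=> j; exact: succ_double_sizes.
Qed.

Lemma sparse_value_unit w : (forall j, (w j < n j)%N) -> 0 <= sparse_value R n w < 1.
Proof.
move=> wn; have := @value_cell R (double_sizes n) (sparse_weight R n) _ _ _ w 0.
rewrite in_cell_nil//; apply => //.
- exact: sparse_weight_split.
- exact: sparse_weight_gt0.
- by move=> j; exact: succ_double_sizes.
Qed.

Lemma decode_encode w : (forall j, (w j < n j)%N) -> decode (encode w) = w.
Proof.
move=> wn; rewrite /encode; case: ifPn => [/set_mem[_ [ns dw]]|_].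
  by rewrite /decode memNset.
rewrite /decode mem_set ?sparse_digits_value//.
by split; [exact: sparse_value_unit|move=> j; rewrite sparse_digits_value].
Qed.

(** The sparse set being null, this makes Lebesgue measure the image under
[encode] of the law of the digits of a uniform point. *)
Lemma encode_digits x : 0 <= x < 1 -> ~ sparse_set n x -> encode (digits n p x) = x.
Proof.
move=> x01 ns; have vx : value p (digits n p x) = x by exact: (value_digits n_gt0).
by rewrite /encode mem_set ?vx// /regular_seq /= vx.
Qed.

Lemma encode_unit w : (forall j, (w j < n j)%N) -> 0 <= encode w < 1.
Proof.
move=> wn; rewrite /encode; case: ifPn => [/set_mem[]//|_].
exact: sparse_value_unit.
Qed.

Lemma decode_lt x j : (decode x j < n j)%N.
Proof.
rewrite /decode; case: ifPn => [/set_mem[_ //]|_]; exact: digits_lt.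
Qed.

Lemma measurable_regular_seq : measurable regular_seq.
Proof.
have mv := @measurable_value R p.
rewrite (_ : regular_seq = (value p @^-1` (@co01 R `&` ~` sparse_set n)) `&`
    \bigcap_j [set w : seqspace | digits n p (value p w) j == w j]).
  apply: measurableI.
    rewrite -[X in measurable X]setTI; apply: mv => //.
    apply: measurableI; first exact: (@measurable_co01 R).
    by apply: measurableC; exact: (@measurable_sparse_set R n).
  apply: bigcapT_measurable => j.
  rewrite (_ : [set _ | _] = (fun w : seqspace => digits n p (value p w) j == w j) @^-1` [set true]).
    rewrite -[X in measurable X]setTI; apply: measurable_fun_eqn => //.
      by apply: (measurableT_comp (measurable_digits n p j)).
    exact: measurable_coordinate.
  by apply/seteqP; split.
apply/seteqP; split => w.
  move=> [w01 [ns dw]]; split; first by split=> //; rewrite /co01 /= in_itv.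
  by move=> j _ /=; rewrite dw.
move=> [[w01 ns] dw]; split; first by move: w01; rewrite /co01 /= in_itv.
by split=> //; apply/funext => j; exact/eqP/dw.
Qed.

Lemma measurable_encode : measurable_fun setT (encode : seqspace -> mR).
Proof.
apply: measurable_fun_ifT.
- apply: (measurable_fun_bool true).
  rewrite setTI (_ : _ @^-1` _ = regular_seq); first exact: measurable_regular_seq.
  by apply/seteqP; split => w /= => [/set_mem|/mem_set].
- exact: measurable_value.
- exact: measurable_value.
Qed.

Lemma measurable_decode : measurable_fun setT decode.
Proof.
apply: measurable_fun_ifT.
- apply: (measurable_fun_bool true).
  rewrite setTI (_ : _ @^-1` _ = sparse_set n); first exact: measurable_sparse_set.
  by apply/seteqP; split => w /= => [/set_mem|/mem_set].
- by apply: measurable_to_seqspace => j; exact: measurable_digits.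
- by apply: measurable_to_seqspace => j; exact: measurable_digits.
Qed.

End embedding.

(** * Words of pairs of letters *)

Section pair_words.
Variables (R : realType) (n : nat -> nat).
Hypothesis n_gt0 : forall j, (0 < n j)%N.

(** The pair of letters (a, b) is coded by the single letter [a * n j + b]; the
interval coding then applies to pairs of words without change. *)
Definition square_sizes (j : nat) := (n j * n j)%N.

Fixpoint fst_word (z : seq nat) : seq nat :=
  if z is c :: z' then (c %/ n (size z'))%N :: fst_word z' else [::].

Fixpoint snd_word (z : seq nat) : seq nat :=
  if z is c :: z' then (c %% n (size z'))%N :: snd_word z' else [::].

Lemma size_fst_word z : size (fst_word z) = size z.
Proof. by elim: z => //= c z ->. Qed.

Lemma size_snd_word z : size (snd_word z) = size z.
Proof. by elim: z => //= c z ->. Qed.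

Lemma sum_square_letters (V : nmodType) N (F : nat -> nat -> V) : (0 < N)%N ->
  \sum_(c < N * N) F (c %/ N)%N (c %% N)%N = \sum_(a < N) \sum_(b < N) F a b.
Proof.
move=> N0; rewrite -(big_mkord xpredT (fun c => F (c %/ N)%N (c %% N)%N)).
rewrite big_nat_mul big_mkord; apply: eq_bigr => a _.
rewrite -{1}[(a * N)%N]add0n big_addn mulSn addnK big_mkord.
apply: eq_bigr => b _.
by rewrite addnC divnMDl// divn_small// addn0 modnMDl modn_small.
Qed.

Lemma sum_square_words (V : nmodType) m (H : seq nat -> seq nat -> V) :
  \sum_(z <- words square_sizes m) H (fst_word z) (snd_word z) =
  \sum_(w <- words n m) \sum_(v <- words n m) H w v.
Proof.
elim: m H => [|m IH] H; first by rewrite !big_seq1.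
rewrite [RHS]sum_words_recr.
under [RHS]eq_bigr => w _ do
  (under eq_bigr => a _ do rewrite sum_words_recr; rewrite exchange_big /=).
pose H' w v := \sum_(a < n m) \sum_(b < n m) H (nat_of_ord a :: w) (nat_of_ord b :: v).
rewrite -/(H' _ _) -(IH H') sum_words_recr big_seq [RHS]big_seq.
apply: eq_bigr => z /words_size sz.
by rewrite /= sz (sum_square_letters (fun a b => H (a :: fst_word z) (b :: snd_word z))).
Qed.

End pair_words.

(** * Realization of the two word laws *)

Section realization.
Variables (R : realType) (n : nat -> nat).
Variables (p : seq nat -> R) (nu : seq nat -> seq nat -> R).
Hypothesis n_gt0 : forall j, (0 < n j)%N.
Hypothesis p_ge0 : forall w, 0 <= p w.
Hypothesis p_nil : p [::] = 1.
Hypothesis p_split : forall w, p w = \sum_(a < n (size w)) p (nat_of_ord a :: w).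
Hypothesis p_small : forall e, 0 < e -> exists m, forall w, size w = m -> p w <= e.
Hypothesis nu_ge0 : forall w v, 0 <= nu w v.
Hypothesis nu_nil : nu [::] [::] = 1.
Hypothesis nu_split : forall w v, size w = size v ->
  nu w v = \sum_(a < n (size w)) \sum_(b < n (size w))
    nu (nat_of_ord a :: w) (nat_of_ord b :: v).

Local Notation mR := (measurableTypeR R).

Definition pair_weight (z : seq nat) : R := nu (fst_word n z) (snd_word n z).

Definition pair_code (t : mR) (j : nat) : nat :=
  digits (square_sizes n) pair_weight t j.

Definition fst_seq (t : mR) : seqspace := fun j => (pair_code t j %/ n j)%N.
Definition snd_seq (t : mR) : seqspace := fun j => (pair_code t j %% n j)%N.

Let square_gt0 j : (0 < square_sizes n j)%N.
Proof. by rewrite muln_gt0 n_gt0. Qed.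

Lemma pair_weight_split z :
  pair_weight z = \sum_(c < square_sizes n (size z)) pair_weight (nat_of_ord c :: z).
Proof.
rewrite /pair_weight nu_split ?size_fst_word ?size_snd_word//.
by rewrite -(sum_square_letters (fun a b => nu (a :: _) (b :: _))).
Qed.

Lemma fst_seq_lt t j : (fst_seq t j < n j)%N.
Proof. by rewrite ltn_divLR//; exact: digits_lt. Qed.

Lemma snd_seq_lt t j : (snd_seq t j < n j)%N.
Proof. by rewrite ltn_mod. Qed.

Lemma measurable_fst_seq : measurable_fun setT fst_seq.
Proof.
apply: measurable_to_seqspace => j.
apply: (@measurableT_comp _ _ _ mR nat nat (fun c => c %/ n j)%N) => //.
exact: measurable_digits.
Qed.

Lemma measurable_snd_seq : measurable_fun setT snd_seq.
Proof.
apply: measurable_to_seqspace => j.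
apply: (@measurableT_comp _ _ _ mR nat nat (fun c => c %% n j)%N) => //.
exact: measurable_digits.
Qed.

Lemma fst_word_code t m :
  fst_word n (code (square_sizes n) pair_weight t m) = prefix_word (fst_seq t) m.
Proof. by elim: m => //= m ->; rewrite size_code. Qed.

Lemma snd_word_code t m :
  snd_word n (code (square_sizes n) pair_weight t m) = prefix_word (snd_seq t) m.
Proof. by elim: m => //= m ->; rewrite size_code. Qed.

Lemma pair_code_integral m (H : seq nat -> seq nat -> R) :
  (\int[unif R]_t (H (prefix_word (fst_seq t) m) (prefix_word (snd_seq t) m))%:E =
   (\sum_(w <- words n m) \sum_(v <- words n m) nu w v * H w v)%:E)%E.
Proof.
under eq_integral do rewrite -fst_word_code -snd_word_code.
rewrite (code_integral _ _ _ _ m (fun z => H (fst_word n z) (snd_word n z)))//.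
- by rewrite -(sum_square_words n_gt0 m (fun w v => nu w v * H w v)).
- by move=> z; exact: nu_ge0.
- exact: pair_weight_split.
Qed.

Lemma integral_unit_interval (f : mR -> \bar R) :
  measurable_fun setT f -> (forall x, 0 <= f x)%E ->
  (\int[@lebesgue_measure R]_(x in unit_interval R) f x = \int[unif R]_x f x)%E.
Proof.
by move=> mf f0; rewrite integral_uniform// subr0 invr1 mul1e.
Qed.

(** Points outside [0, 1) and points of the sparse set are negligible; they are
the only ones that the digits may fail to determine. *)
Lemma unif_ae (f g : mR -> \bar R) :
  measurable_fun setT f -> measurable_fun setT g ->
  (forall x, 0 <= f x)%E -> (forall x, 0 <= g x)%E ->
  (forall x, 0 <= x < 1 -> ~ sparse_set n x -> f x = g x) ->
  (\int[unif R]_x f x = \int[unif R]_x g x)%E.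
Proof.
move=> mf mg f0 g0 fg.
pose N : set mR := ~` (@co01 R) `|` sparse_set n.
have mN : measurable N.
  apply: measurableU; first exact: (measurableC (@measurable_co01 R)).
  exact: (@measurable_sparse_set R n).
apply: ge0_ae_eq_integral => //; exists N; split=> //.
- apply/eqP; rewrite eq_le measure_ge0 andbT.
  apply: le_trans (measureU2 _ _ _) _.
  + exact: (measurableC (@measurable_co01 R)).
  + exact: (@measurable_sparse_set R n).
  rewrite [X in (_ + X)%E](_ : _ = 0%E) ?adde0; last exact: unif_sparse_set.
  have := unif_setI_co01 (measurableC (@measurable_co01 R)).
  by rewrite setICl measure0 => h; rewrite le_eqVlt; apply/orP; left; apply/eqP; exact: esym h.
- move=> x /=; apply: contra_notP => /not_orP[/contrapT x01 ns] _.
  by apply: fg => //; move: x01; rewrite /co01 /= in_itv.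
Qed.

Let dec := decode n p.
Let enc := encode n p.

(** A uniform point [t] codes a random pair of sequences; the law of their images
in the unit square is the measure sought. *)
Definition embedded_pair (t : mR) : mR * mR := (enc (fst_seq t), enc (snd_seq t)).

Let measurable_enc : measurable_fun setT (enc : seqspace -> mR).
Proof. exact: measurable_encode. Qed.

Let measurable_embedded_pair : measurable_fun setT embedded_pair.
Proof.
apply: measurable_fun_pair.
- by apply: (measurableT_comp measurable_enc); exact: measurable_fst_seq.
- by apply: (measurableT_comp measurable_enc); exact: measurable_snd_seq.
Qed.

Let embedded_pair_mfun : {mfun mR >-> (mR * mR)%type} :=
  HB.pack embedded_pair (isMeasurableFun.Build _ _ _ _ _ measurable_embedded_pair).

Definition embedded_law : probability (mR * mR)%type R :=
  distribution (unif R) embedded_pair_mfun.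

Lemma embedded_law_integral (f : mR * mR -> \bar R) :
  measurable_fun (unit_square R) f -> (forall q, unit_square R q -> 0 <= f q)%E ->
  (\int[embedded_law]_(q in unit_square R) f q =
   \int[unif R]_t f (embedded_pair t))%E.
Proof.
move=> mf f0.
have msq : measurable (unit_square R) by apply: measurableX; exact: measurable_itv.
have sqE : embedded_pair @^-1` (unit_square R) = setT.
  apply/seteqP; split => // t _; split; rewrite /unit_interval /= in_itv /=.
  - by have /andP[-> /ltW ->] : 0 <= enc (fst_seq t) < 1 by apply: encode_unit => //; exact: fst_seq_lt.
  - by have /andP[-> /ltW ->] : 0 <= enc (snd_seq t) < 1 by apply: encode_unit => //; exact: snd_seq_lt.
rewrite [LHS](ge0_integral_pushforward (measurable_embedded_pair))//.
  by rewrite sqE.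
by move=> q /set_mem; exact: f0.
Qed.

Let measurable_dec : measurable_fun setT (dec : mR -> seqspace).
Proof. exact: measurable_decode. Qed.

Let measurable_word (X : mR -> seqspace) m (F : seq nat -> R) :
  measurable_fun setT X -> measurable_fun setT (fun x => F (prefix_word (X x) m)).
Proof.
by move=> mX; apply: (measurableT_comp (measurable_word_fun m F) mX).
Qed.

Let measurable_digits_seq : measurable_fun setT (digits n p : mR -> seqspace).
Proof. by apply: measurable_to_seqspace => j; exact: measurable_digits. Qed.

Lemma decoded_integral m F : (forall w, 0 <= F w) ->
  (\int[@lebesgue_measure R]_(x in unit_interval R) (F (prefix_word (dec x) m))%:E =
   (\sum_(w <- words n m) p w * F w)%:E)%E.
Proof.
move=> F0; have mF X := @measurable_word X m F.
rewrite integral_unit_interval; last 2 first.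
- by apply/measurable_EFinP; exact: mF.
- by move=> x; rewrite lee_fin.
rewrite (@unif_ae _ (fun x => (F (code n p x m))%:E)).
- exact: code_integral.
- by apply/measurable_EFinP; exact: mF.
- under eq_fun do rewrite -prefix_digits.
  by apply/measurable_EFinP; exact: mF.
- by move=> x; rewrite lee_fin.
- by move=> x; rewrite lee_fin.
- by move=> x x01 ns; rewrite /dec /decode memNset// prefix_digits.
Qed.

Lemma decoded_pair_integral m F H : (forall w, 0 <= F w) -> (forall w, 0 <= H w) ->
  (\int[embedded_law]_(q in unit_square R)
     (F (prefix_word (dec q.1) m) * H (prefix_word (dec q.2) m))%:E =
   (\sum_(w <- words n m) \sum_(v <- words n m) nu w v * (F w * H v))%:E)%E.
Proof.
move=> F0 H0; rewrite embedded_law_integral; last 2 first.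
- apply/measurable_EFinP/measurable_funTS/measurable_funM.
  + by apply: (measurableT_comp (measurable_word m F measurable_dec)); exact: measurable_fst.
  + by apply: (measurableT_comp (measurable_word m H measurable_dec)); exact: measurable_snd.
- by move=> q _; rewrite lee_fin mulr_ge0.
rewrite -(pair_code_integral m (fun w v => F w * H v)).
apply: eq_integral => t _ /=.
have -> : dec (enc (fst_seq t)) = fst_seq t.
  by apply: decode_encode => // j; exact: fst_seq_lt.
have -> // : dec (enc (snd_seq t)) = snd_seq t.
by apply: decode_encode => // j; exact: snd_seq_lt.
Qed.

Section approximation.
Variables (k : nat) (g : 'I_k -> mR -> R).
Hypothesis k_gt0 : (0 < k)%N.
Hypothesis mg : forall i, measurable_fun (unit_interval R) (g i).
Hypothesis g_ge0 : forall i x, unit_interval R x -> 0 <= g i x.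
Hypothesis g_sum : forall x, unit_interval R x -> \sum_i g i x = 1.

Let g0 i : mR -> R := g i \_ (unit_interval R).

Let g0E i x : unit_interval R x -> g0 i x = g i x.
Proof. by move=> x01; rewrite /g0 patchE mem_set. Qed.

Let g0_bounds i x : 0 <= g0 i x <= 1.
Proof.
rewrite /g0 patchE; case: ifPn => [/set_mem x01|_]; last by rewrite lexx ler01.
rewrite g_ge0//= -(g_sum x01) (bigD1 i)//= lerDl.
by apply: sumr_ge0 => j _; exact: g_ge0.
Qed.

Let measurable_g0 i : measurable_fun setT (g0 i).
Proof.
apply/(measurable_restrictT _ _).1; last exact: mg.
exact: measurable_itv.
Qed.

Let G i (w : seqspace) : R := g0 i (enc w).

Let G_bounds i w : 0 <= G i w <= 1.
Proof. exact: g0_bounds. Qed.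

Let measurable_G i : measurable_fun setT (G i).
Proof. exact: (measurableT_comp (measurable_g0 i) measurable_enc). Qed.

Let enc_unit w : (forall j, (w j < n j)%N) -> unit_interval R (enc w).
Proof.
move=> wn; rewrite /unit_interval /= in_itv /=.
by have /andP[-> /ltW ->] : 0 <= enc w < 1 by exact: encode_unit.
Qed.

Let G_sum w : (forall j, (w j < n j)%N) -> \sum_i G i w = 1.
Proof.
move=> wn; rewrite -(g_sum (enc_unit wn)); apply: eq_bigr => i _.
by rewrite /G g0E//; exact: enc_unit.
Qed.

Let integral_G i c :
  (\int[@lebesgue_measure R]_(x in unit_interval R) (g i x)%:E = c%:E)%E ->
  \int[unif R]_x G i (digits n p x) = c.
Proof.
move=> gc; rewrite /Rintegral -[RHS]/(fine c%:E) -gc; congr fine.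
rewrite [RHS](eq_integral (fun x => (g0 i x)%:E)) => [|x /set_mem x01]; last by rewrite g0E.
have g00 x : (0 <= (g0 i x)%:E)%E by rewrite lee_fin; have /andP[] := g0_bounds i x.
rewrite integral_unit_interval//; last exact/measurable_EFinP.
apply: unif_ae => //.
- apply/measurable_EFinP.
  exact: (measurableT_comp (measurable_G i) measurable_digits_seq).
- exact/measurable_EFinP.
- by move=> x; rewrite lee_fin; have /andP[] := G_bounds i (digits n p x).
- by move=> x x01 ns; rewrite /G /enc encode_digits.
Qed.

Let integral_GG i j c :
  (\int[embedded_law]_(q in unit_square R) (g i q.1 * g j q.2)%:E = c%:E)%E ->
  \int[unif R]_t (G i (fst_seq t) * G j (snd_seq t)) = c.
Proof.
move=> gc; rewrite /Rintegral -[RHS]/(fine c%:E) -gc; congr fine.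
rewrite [RHS](eq_integral (fun q => (g0 i q.1 * g0 j q.2)%:E)) => [|q /set_mem[q1 q2]]; last first.
  by rewrite !g0E.
rewrite embedded_law_integral//.
- apply/measurable_EFinP/measurable_funTS/measurable_funM.
  + by apply: (measurableT_comp (measurable_g0 i)); exact: measurable_fst.
  + by apply: (measurableT_comp (measurable_g0 j)); exact: measurable_snd.
- move=> q _; rewrite lee_fin mulr_ge0//.
  + by have /andP[] := g0_bounds i q.1.
  + by have /andP[] := g0_bounds j q.2.
Qed.

Let seq_law (X : mR -> seqspace) (mX : measurable_fun setT X) :
    {measure set seqspace -> \bar R} :=
  distribution (unif R)
    (HB.pack X (isMeasurableFun.Build _ _ _ _ X mX) : {mfun mR >-> seqspace}).

(** One finite measure that dominates the vertex law and both marginals of the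
edge law: approximating in it serves all three integrals at once. *)
Let total_law : {measure set seqspace -> \bar R} :=
  measure_add (seq_law measurable_digits_seq)
    (measure_add (seq_law measurable_fst_seq) (seq_law measurable_snd_seq)).

Let total_lawE A : total_law A = (unif R (digits n p @^-1` A) +
  (unif R (fst_seq @^-1` A) + unif R (snd_seq @^-1` A)))%E.
Proof.
apply: etrans; first exact: measure_addE.
by congr (_ + _)%E; exact: measure_addE.
Qed.

(** Every fractional partition of [0, 1] can be replaced by a partition of words,
at an arbitrarily small cost for its integrals and for its matrix. *)
Lemma approximate_integrals (e : R) : 0 < e ->
  exists m (F : 'I_k -> seq nat -> R),
  [/\ forall i v, 0 <= F i v, forall v, \sum_i F i v = 1,
    forall i c,
      (\int[@lebesgue_measure R]_(x in unit_interval R) (g i x)%:E = c%:E)%E ->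
      `|c - \sum_(w <- words n m) p w * F i w| <= e
  & forall i j c,
      (\int[embedded_law]_(q in unit_square R) (g i q.1 * g j q.2)%:E = c%:E)%E ->
      `|c - \sum_(w <- words n m) \sum_(v <- words n m) nu w v * (F i w * F j v)| <= e].
Proof.
(* In the product of two factors, each factor changes by at most [d] outside a bad
   event of measure at most [d]. *)
move=> e0; pose d := e / 4.
have d0 : 0 < d by rewrite divr_gt0.
have fin : (total_law setT < +oo)%E.
  by rewrite total_lawE !preimage_setT !probability_setT ltry.
have [m [F [B [mB Bd F0 F1 GF]]]] := approximate_partition fin k_gt0 measurable_G G_bounds d0.
have F01 i v : 0 <= F i v <= 1.
  by rewrite F0 -(F1 v) (bigD1 i)//= lerDl sumr_ge0.
have [Bx [Ba Bb]] : [/\ (unif R (digits n p @^-1` B) <= d%:E)%E,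
    (unif R (fst_seq @^-1` B) <= d%:E)%E & (unif R (snd_seq @^-1` B) <= d%:E)%E].
  move: Bd; rewrite total_lawE => /ltW Bd; split; apply: le_trans Bd.
  - by rewrite leeDl// adde_ge0.
  - by rewrite addeCA leeDl// adde_ge0.
  - by rewrite addeA leeDr// adde_ge0.
have mpre (X : mR -> seqspace) : measurable_fun setT X -> measurable (X @^-1` B).
  by move=> mX; rewrite -[X in measurable X]setTI; exact: mX.
exists m, F; split=> //.
- move=> i c /integral_G <-.
  have <- : \int[unif R]_x F i (prefix_word (digits n p x) m) =
    \sum_(w <- words n m) p w * F i w.
    rewrite /Rintegral; under eq_integral do rewrite prefix_digits.
    by rewrite code_integral.
  apply: le_trans (_ : d + d <= _); last by rewrite /d; lra.
  apply: (@close_integral _ mR R (unif R) (fun x => G i (digits n p x))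
    (fun x => F i (prefix_word (digits n p x) m)) (digits n p @^-1` B)) => //.
  + exact: (measurableT_comp (measurable_G i) measurable_digits_seq).
  + exact: measurable_word.
  + exact: mpre.
  + by move=> x nB; apply: GF => //; apply: G_sum => j; exact: digits_lt.
  + exact: ltW.
- move=> i j c /integral_GG <-.
  have <- : \int[unif R]_t (F i (prefix_word (fst_seq t) m) * F j (prefix_word (snd_seq t) m)) =
    \sum_(w <- words n m) \sum_(v <- words n m) nu w v * (F i w * F j v).
    by rewrite /Rintegral (pair_code_integral m (fun w v => F i w * F j v)).
  apply: le_trans (_ : (d + d) + (d + d) <= _); last by rewrite /d; lra.
  apply: (@close_integral _ mR R (unif R) (fun t => G i (fst_seq t) * G j (snd_seq t))
    (fun t => F i (prefix_word (fst_seq t) m) * F j (prefix_word (snd_seq t) m))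
    (fst_seq @^-1` B `|` snd_seq @^-1` B)) => //.
  + apply: measurable_funM.
      exact: (measurableT_comp (measurable_G i) measurable_fst_seq).
    exact: (measurableT_comp (measurable_G j) measurable_snd_seq).
  + apply: measurable_funM; apply: measurable_word; first exact: measurable_fst_seq.
    exact: measurable_snd_seq.
  + apply: measurableU; apply: mpre; first exact: measurable_fst_seq.
    exact: measurable_snd_seq.
  + move=> t; have /andP[a1 a2] := G_bounds i (fst_seq t).
    have /andP[b1 b2] := G_bounds j (snd_seq t).
    by rewrite mulr_ge0//= mulr_ile1.
  + move=> t; have /andP[a1 a2] := F01 i (prefix_word (fst_seq t) m).
    have /andP[b1 b2] := F01 j (prefix_word (snd_seq t) m).
    by rewrite mulr_ge0//= mulr_ile1.
  + move=> t /not_orP[nB1 nB2].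
    have h1 : `|G i (fst_seq t) - F i (prefix_word (fst_seq t) m)| <= d.
      by apply: GF => //; apply: G_sum => l; exact: fst_seq_lt.
    have h2 : `|G j (snd_seq t) - F j (prefix_word (snd_seq t) m)| <= d.
      by apply: GF => //; apply: G_sum => l; exact: snd_seq_lt.
    exact: dist_mul_le.
  + by rewrite addr_ge0// ltW.
  + apply: le_trans (measureU2 _ _ _) _.
    * by apply: mpre; exact: measurable_fst_seq.
    * by apply: mpre; exact: measurable_snd_seq.
    * by rewrite EFinD leeD.
Qed.

End approximation.

End realization.

(** * Statistics of a finite graph *)

Section graph_statistics.
Variables (R : realType) (H : graph).
Hypothesis H_edge : has_edge H.

Local Notation n := #|H|.
Local Notation A := (adjacency R H).
Local Notation s := (l1norm A).
Implicit Types x y : 'I_n -> R.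

Definition vertex_mean x : R := n%:R^-1 * \sum_v x v.

(** The bilinear form behind C_0(G,k): the mean of [x u * y v] over a uniform
random directed edge (u, v). *)
Definition edge_mean x y : R := s^-1 * \sum_u \sum_v A u v * (x u * y v).

Lemma adjacency_ge0 u v : 0 <= A u v.
Proof. by rewrite mxE ler0n. Qed.

Lemma l1norm_adjacency : s = \sum_u \sum_v A u v.
Proof.
by apply: eq_bigr => u _; apply: eq_bigr => v _; rewrite ger0_norm ?adjacency_ge0.
Qed.

Lemma l1norm_adjacency_gt0 : 0 < s.
Proof.
have [u [v uv]] := H_edge; rewrite l1norm_adjacency.
rewrite (bigD1 (enum_rank u))//= (bigD1 (enum_rank v))//= mxE !enum_rankK uv.
rewrite -addrA ltr_wpDr ?ltr01// addr_ge0// ?sumr_ge0// => *; last first.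
  by apply: sumr_ge0 => *; exact: adjacency_ge0.
exact: adjacency_ge0.
Qed.

Lemma card_vertices_gt0 : (0 < n)%N.
Proof. by have [u _] := H_edge; apply/card_gt0P; exists u. Qed.

Lemma vertex_mean_cst c : vertex_mean (fun=> c) = c.
Proof.
rewrite /vertex_mean sumr_const card_ord -[c *+ _]mulr_natl mulKf//.
by rewrite pnatr_eq0 -lt0n card_vertices_gt0.
Qed.

Lemma edge_mean1 : edge_mean (fun=> 1) (fun=> 1) = 1.
Proof.
rewrite /edge_mean (_ : \sum_u _ = s) ?mulVf ?gt_eqF ?l1norm_adjacency_gt0//.
rewrite l1norm_adjacency; apply: eq_bigr => u _; apply: eq_bigr => v _.
by rewrite !mulr1.
Qed.

Lemma vertex_mean_sum (I : Type) (r : seq I) (c : I -> R) (x : I -> 'I_n -> R) :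
  vertex_mean (fun v => \sum_(i <- r) c i * x i v) =
  \sum_(i <- r) c i * vertex_mean (x i).
Proof.
rewrite /vertex_mean exchange_big mulr_sumr; apply: eq_bigr => i _.
by rewrite -mulr_sumr mulrCA.
Qed.

Lemma edge_mean_sum (I : Type) (r r' : seq I) (c d : I -> R)
    (x y : I -> 'I_n -> R) :
  edge_mean (fun u => \sum_(i <- r) c i * x i u) (fun v => \sum_(j <- r') d j * y j v) =
  \sum_(i <- r) \sum_(j <- r') c i * d j * edge_mean (x i) (y j).
Proof.
rewrite /edge_mean.
under eq_bigr => u _ do under eq_bigr => v _ do
  (rewrite mulr_suml mulr_sumr; under eq_bigr => i _ do rewrite mulr_sumr mulr_sumr).
under eq_bigr => u _ do (rewrite exchange_big /=; under eq_bigr => i _ do rewrite exchange_big /=).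
rewrite exchange_big mulr_sumr; apply: eq_bigr => i _.
rewrite exchange_big mulr_sumr; apply: eq_bigr => j _.
rewrite mulrCA; congr (_ * _); rewrite mulr_sumr; apply: eq_bigr => u _.
rewrite mulr_sumr; apply: eq_bigr => v _.
by ring.
Qed.

Lemma vertex_mean_mono x y : (forall v, x v <= y v) -> vertex_mean x <= vertex_mean y.
Proof.
by move=> xy; rewrite ler_wpM2l ?invr_ge0//; apply: ler_sum => v _; exact: xy.
Qed.

Lemma vertex_mean_bounds x : (forall v, 0 <= x v <= 1) -> 0 <= vertex_mean x <= 1.
Proof.
move=> x01; apply/andP; split.
  by rewrite mulr_ge0 ?invr_ge0 ?sumr_ge0// => v _; have /andP[] := x01 v.
rewrite -[leRHS](vertex_mean_cst 1); apply: vertex_mean_mono => v.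
by have /andP[] := x01 v.
Qed.

Lemma edge_mean_close x y x' y' (e : R) :
  (forall u v, `|x u * y v - x' u * y' v| <= e) ->
  `|edge_mean x y - edge_mean x' y'| <= e.
Proof.
move=> xye; have s0 := l1norm_adjacency_gt0.
rewrite /edge_mean -mulrBr normrM (ger0_norm (ltW _)) ?invr_gt0//.
rewrite ler_pdivrMl// l1norm_adjacency mulr_suml -sumrB.
rewrite (le_trans (ler_norm_sum _ _ _))//; apply: ler_sum => u _.
rewrite -sumrB mulr_suml (le_trans (ler_norm_sum _ _ _))//; apply: ler_sum => v _.
by rewrite -mulrBr normrM (ger0_norm (adjacency_ge0 u v)) ler_wpM2l ?adjacency_ge0.
Qed.

Lemma edge_mean_bounds x y : (forall v, 0 <= x v <= 1) -> (forall v, 0 <= y v <= 1) ->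
  0 <= edge_mean x y <= 1.
Proof.
move=> x01 y01; apply/andP; split.
  rewrite mulr_ge0 ?invr_ge0 ?(ltW l1norm_adjacency_gt0)//.
  apply: sumr_ge0 => u _; apply: sumr_ge0 => v _.
  have /andP[x0 _] := x01 u; have /andP[y0 _] := y01 v.
  by rewrite mulr_ge0 ?adjacency_ge0 ?mulr_ge0.
rewrite -edge_mean1 /edge_mean ler_wpM2l ?invr_ge0 ?(ltW l1norm_adjacency_gt0)//.
apply: ler_sum => u _; apply: ler_sum => v _.
have /andP[x0 x1] := x01 u; have /andP[y0 y1] := y01 v.
by rewrite ler_wpM2l ?adjacency_ge0// mulr1 mulr_ile1.
Qed.

Lemma C0_entry k (M : 'M[R]_(k, n)) a b :
  (s^-1 *: (M *m A *m M^T)) a b = edge_mean (M a) (M b).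
Proof.
rewrite mxE; congr (_ * _); rewrite mxE.
under eq_bigr => v _ do rewrite !mxE mulr_suml.
rewrite exchange_big; apply: eq_bigr => u _; apply: eq_bigr => v _.
by ring.
Qed.

Lemma const_Kset k : (0 < k)%N -> Kset R k n (const_mx k%:R^-1).
Proof.
move=> k0; split.
- by move=> a i; rewrite mxE invr_ge0.
- by move=> a; under eq_bigr do rewrite mxE; rewrite sumr_const card_ord mulr_natl.
- move=> i; under eq_bigr do rewrite mxE.
  by rewrite sumr_const card_ord -[LHS]mulr_natl divff// pnatr_eq0 -lt0n.
Qed.

Lemma Kset_le1 k (M : 'M[R]_(k, n)) a v : Kset R k n M -> 0 <= M a v <= 1.
Proof.
by move=> [M0 _ M1]; rewrite M0 -(M1 v) (bigD1 a)//= lerDl sumr_ge0.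
Qed.

Lemma Kset_mean k (M : 'M[R]_(k, n)) a : Kset R k n M -> vertex_mean (M a) = k%:R^-1.
Proof.
move=> [_ Mr _]; rewrite /vertex_mean Mr mulrA mulVf ?mul1r//.
by rewrite pnatr_eq0 -lt0n card_vertices_gt0.
Qed.

(** Mixing [N] with weight [1 - d] and constant functions with total weight [d]
allows the means to be corrected to exactly [1/k], provided that they are off
by at most [d/k]: this is what keeps the constants nonnegative. *)
Lemma adjust_to_Kset k (N : 'I_k -> 'I_n -> R) (d : R) : (0 < k)%N -> 0 < d <= 1 ->
  (forall a v, 0 <= N a v) -> (forall v, \sum_a N a v = 1) ->
  (forall a, `|k%:R^-1 - vertex_mean (N a)| <= d / k%:R) ->
  exists2 M : 'M[R]_(k, n), Kset R k n M &
    forall a b, `|edge_mean (M a) (M b) - edge_mean (N a) (N b)| <= d + d.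
Proof.
move=> k0 /andP[d0 d1] N0 N1 Nd.
have k0R : (0 : R) < k%:R by rewrite ltr0n.
have n0R : (0 : R) < n%:R by rewrite ltr0n card_vertices_gt0.
have kNE : \sum_(a < k) (k%:R^-1 : R) = 1.
  by rewrite sumr_const card_ord -[LHS]mulr_natl divff// gt_eqF.
pose m a := vertex_mean (N a).
have m1 : \sum_a m a = 1.
  rewrite /m /vertex_mean -mulr_sumr exchange_big /=.
  by under eq_bigr do rewrite N1; rewrite sumr_const card_ord mulVf// gt_eqF.
(* [t a / d] is the constant mixed with the row [a]; its value is forced by the
   requirement that the new row has mean 1/k. *)
pose t a := d / k%:R + (1 - d) * (k%:R^-1 - m a).
have t0 a : 0 <= t a.
  have := Nd a; rewrite -/(m a) ler_norml => /andP[lo _]; rewrite /t.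
  have h : (1 - d) * (- (d / k%:R)) <= (1 - d) * (k%:R^-1 - m a).
    by rewrite ler_wpM2l// subr_ge0.
  have h2 : 0 <= d * (d / k%:R) by rewrite mulr_ge0 ?divr_ge0// ltW.
  by move: h h2; set q := d / _; set z := (1 - d) * (_ - _); lra.
have t1 : \sum_a t a = d.
  rewrite /t big_split /= -mulr_sumr -mulr_sumr sumrB kNE m1; lra.
have td a : t a <= d by rewrite -t1 (bigD1 a)//= lerDl sumr_ge0.
pose M : 'M[R]_(k, n) := \matrix_(a, v) ((1 - d) * N a v + t a).
have ME a v : M a v = (1 - d) * N a v + t a by rewrite mxE.
have N01 a v : 0 <= N a v <= 1.
  by rewrite N0 -(N1 v) (bigD1 a)//= lerDl sumr_ge0.
have KM : Kset R k n M.
  split.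
  - by move=> a v; rewrite ME addr_ge0// mulr_ge0// subr_ge0.
  - move=> a; under eq_bigr do rewrite ME.
    rewrite big_split /= -mulr_sumr sumr_const card_ord -mulr_natl.
    have -> : \sum_v N a v = n%:R * m a by rewrite /m /vertex_mean mulVKf// gt_eqF.
    by rewrite /t; ring.
  - move=> v; under eq_bigr do rewrite ME.
    by rewrite big_split /= -mulr_sumr N1 t1; lra.
exists M => // a b; apply: edge_mean_close => u v.
have NM c w : `|M c w - N c w| <= d.
  rewrite ME; have /andP[n0 n1] := N01 c w.
  have h : 0 <= d * N c w by rewrite mulr_ge0// ltW.
  have h1 : d * N c w <= d by rewrite ler_piMr// ltW.
  have := t0 c; have := td c; rewrite ler_norml => *; apply/andP; split; lra.
by apply: dist_mul_le => //; exact: Kset_le1 KM.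
Qed.

End graph_statistics.

(** * Random words attached to vertices *)

Section word_probability.
Variables (R : realType) (V : Type) (n : nat -> nat) (q : nat -> nat -> V -> R).
Hypothesis q_bounds : forall j a v, 0 <= q j a v <= 1.
Hypothesis q_sum : forall j v, \sum_(a < n j) q j a v = 1.

Fixpoint word_prob (w : seq nat) (v : V) : R :=
  if w is a :: w' then word_prob w' v * q (size w') a v else 1.

Lemma word_prob_bounds w v : 0 <= word_prob w v <= 1.
Proof.
elim: w => [|a w /andP[w0 w1]] /=; first by rewrite ler01 lexx.
by have /andP[q0 q1] := q_bounds (size w) a v; rewrite mulr_ge0//= mulr_ile1.
Qed.

Lemma word_prob_split w v :
  word_prob w v = \sum_(a < n (size w)) 1 * word_prob (nat_of_ord a :: w) v.
Proof.
under eq_bigr do rewrite mul1r.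
by rewrite -mulr_sumr q_sum mulr1.
Qed.

Lemma sum_word_prob m v : \sum_(w <- words n m) word_prob w v = 1.
Proof.
elim: m => [|m IH]; first by rewrite big_seq1.
rewrite sum_words_recr -[RHS]IH big_seq [RHS]big_seq.
by apply: eq_bigr => w /words_size <-; rewrite -mulr_sumr q_sum mulr1.
Qed.

Lemma word_prob_last_letter m a v : (a < n m)%N ->
  \sum_(w <- words n m.+1) (head 0%N w == a)%:R * word_prob w v = q m a v.
Proof.
move=> am; rewrite sum_words_recr.
transitivity (\sum_(w <- words n m) word_prob w v * q m a v); last first.
  by rewrite -mulr_suml sum_word_prob mul1r.
rewrite big_seq [RHS]big_seq; apply: eq_bigr => w /words_size sw.
rewrite (bigD1 (Ordinal am))//= eqxx /= mulr1n mul1r sw big1 ?addr0// => b.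
by rewrite -val_eqE /= => /negbTE ->; rewrite mul0r.
Qed.

(** The letters at even places are coins, and half of the letters of [w] are at
even places. *)
Lemma word_prob_coins m w v : (forall j, ~~ odd j -> forall a v, q j a v <= 2^-1) ->
  size w = m.*2 -> word_prob w v <= 2^-1 ^+ m.
Proof.
move=> coin; elim: m w => [|m IH] [|a [|b w]]//.
move=> [sw]; have q1 := q_bounds (size (b :: w)) a v; have q0 := q_bounds (size w) b v.
have c : q (size w) b v <= 2^-1 by apply: coin; rewrite sw odd_double.
have /andP[w0 _] := word_prob_bounds w v.
move: q0 q1 => /andP[q0 _] /andP[q1 q1'].
rewrite [word_prob _ _]/= exprSr -[leRHS]mulr1 ler_pM ?mulr_ge0//.
by rewrite ler_pM// IH.
Qed.

End word_probability.

(** * Limits along an ultrafilter *)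

Section ultralimit.
Variables (R : realType) (U : set_system nat).
Hypothesis U_ultra : UltraFilter U.

Definition ulim (x : nat -> R) : R := lim (x i @[i --> U]).

(** An ultrafilter has at most one way to cluster: the cluster point provided by
compactness is a limit. *)
Lemma ulim_cvg x : (forall i, 0 <= x i <= 1) -> x i @[i --> U] --> ulim x.
Proof.
move=> x01; have UF : ProperFilter U := @ultra_proper _ _ U_ultra.
have xU : ProperFilter (x @ U) by exact: fmap_proper_filter.
have [|p [_ clp]] := @segment_compact R 0 1 (x @ U) xU.
  change (U (x @^-1` `[0, 1]%classic)).
  rewrite (_ : _ @^-1` _ = setT); first exact: filterT.
  by apply/seteqP; split => // i _ /=; rewrite in_itv /=; exact: x01.
apply/cvg_ex => /=; exists p => B nB.
have [//|nUB] := in_ultra_setVsetC (x @^-1` B) U_ultra.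
by have [y []] := clp (~` B) B nUB nB.
Qed.

Lemma ulim_eq x l : x i @[i --> U] --> l -> ulim x = l.
Proof.
have UF : ProperFilter U := @ultra_proper _ _ U_ultra.
exact: cvg_lim.
Qed.

Lemma ulim_sum (I : Type) (r : seq I) (c : I -> R) (x : I -> nat -> R) :
  (forall j i, 0 <= x j i <= 1) ->
  ulim (fun i => \sum_(j <- r) c j * x j i) = \sum_(j <- r) c j * ulim (x j).
Proof.
move=> x01; have UF : ProperFilter U := @ultra_proper _ _ U_ultra.
apply: ulim_eq; apply: (cvg_big add_continuous) => j _; apply: cvgM; first exact: cvg_cst.
exact: ulim_cvg.
Qed.

Lemma ulim_bounds x a b : (forall i, 0 <= x i <= 1) ->
  (forall i, a <= x i <= b) -> a <= ulim x <= b.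
Proof.
move=> x01 xab; have UF : ProperFilter U := @ultra_proper _ _ U_ultra.
have xu := ulim_cvg x01; apply/andP; split.
  apply: (limr_ge (cvgP _ xu)); apply: nearW => i; by have /andP[] := xab i.
apply: (limr_le (cvgP _ xu)); apply: nearW => i; by have /andP[] := xab i.
Qed.

Lemma ulim_near_le x c e : (forall i, 0 <= x i <= 1) ->
  (\forall i \near U, `|x i - c| <= e) -> `|ulim x - c| <= e.
Proof.
move=> x01 xe; have UF : ProperFilter U := @ultra_proper _ _ U_ultra.
have h : `|x i - c| @[i --> U] --> `|ulim x - c|.
  by apply: cvg_norm; apply: cvgB; [exact: ulim_cvg|exact: cvg_cst].
by rewrite -(cvg_lim _ h)//; apply: limr_le => //; exact: cvgP h.
Qed.

Lemma near_ulim x c e d : (forall i, 0 <= x i <= 1) -> 0 < d ->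
  `|c - ulim x| <= e -> \forall i \near U, `|c - x i| <= e + d.
Proof.
move=> x01 d0 ce; have UF : ProperFilter U := @ultra_proper _ _ U_ultra.
have /cvgrPdist_le/(_ d d0) := ulim_cvg x01.
apply: filterS => i xd.
have -> : c - x i = (c - ulim x) + (ulim x - x i) by rewrite addrA subrK.
by rewrite (le_trans (ler_normD _ _))// lerD.
Qed.

End ultralimit.

(** * Letters sampling all approximable statistics *)

Section letters.
Variable R : realType.

(** A target asks for a matrix of order [k.+1] within [1 / N.+1] of a rational
matrix; the targets form a countable type. *)
Definition target := {k : nat & ('M[rat]_k.+1 * nat)%type}.

Definition coin : target := existT _ 1%N (0, 0%N).

(** Even places carry coins, for which only the alphabet size 2 of this value
matters; at odd places that code no target it is an arbitrary target. *)
Definition letter_target (j : nat) : target :=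
  if odd j then odflt coin (unpickle j./2) else coin.

Definition letter_size (j : nat) : nat := (tag (letter_target j)).+1.

Section one_graph.
Variable H : graph.
Hypothesis H_edge : has_edge H.

Definition hits (k : nat) (q : 'M[rat]_k) (N : nat) (M : 'M[R]_(k, #|H|)) :=
  forall a b, `|edge_mean (M a) (M b) - ratr (q a b)| <= N.+1%:R^-1.

Definition uniform_mx (k : nat) : 'M[R]_(k, #|H|) := const_mx k%:R^-1.

Definition sample (t : target) : 'M[R]_((tag t).+1, #|H|) :=
  xget (uniform_mx (tag t).+1)
    [set M | Kset R _ _ M /\ hits (tagged t).1 (tagged t).2 M].

Definition letter_mx (j : nat) : 'M[R]_(letter_size j, #|H|) :=
  if odd j then sample (letter_target j) else uniform_mx (letter_size j).

(** Vanishing outside the alphabet, so that [inord] never wraps around. *)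
Definition letter_prob (j a : nat) (v : 'I_#|H|) : R :=
  if (a < letter_size j)%N then letter_mx j (inord a) v else 0.

Lemma letter_mx_Kset j : Kset R _ _ (letter_mx j).
Proof.
rewrite /letter_mx; case: ifP => _; last exact: const_Kset.
rewrite /sample; case: xgetP => [M _ []//|_]; exact: const_Kset.
Qed.

Lemma letter_mx_hits k (q : 'M[rat]_k.+1) N j :
  letter_target j = existT _ k (q, N) -> odd j ->
  (exists2 M, Kset R _ _ M & hits q N M) ->
  forall a b, (a < k.+1)%N -> (b < k.+1)%N ->
  `|edge_mean (letter_prob j a) (letter_prob j b) - ratr (q (inord a) (inord b))|
  <= N.+1%:R^-1.
Proof.
move=> jt jo [M KM hM] a b ak bk.
rewrite /letter_prob /letter_mx jo.
have : forall t : target, t = existT _ k (q, N) ->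
   hits (tagged t).1 (tagged t).2 (sample t).
  by move=> _ ->; rewrite /sample; case: xgetP => [M' _ [_]//|/(_ M)[]].
move=> /(_ _ jt); rewrite /letter_size.
move: (letter_target j) jt => t jt; rewrite jt /= ak bk => h.
exact: (h (inord a) (inord b)).
Qed.

Lemma letter_prob_bounds j a v : 0 <= letter_prob j a v <= 1.
Proof.
rewrite /letter_prob; case: ifP => _; last by rewrite lexx ler01.
exact: (Kset_le1 _ _ (letter_mx_Kset j)).
Qed.

Lemma letter_prob_ord j (a : 'I_(letter_size j)) v :
  letter_prob j a v = letter_mx j a v.
Proof. by rewrite /letter_prob ltn_ord inord_val. Qed.

Lemma letter_prob_sum j v : \sum_(a < letter_size j) letter_prob j a v = 1.
Proof.
under eq_bigr do rewrite letter_prob_ord.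
by have [_ _] := letter_mx_Kset j; apply.
Qed.

Lemma letter_prob_mean j a : (a < letter_size j)%N ->
  vertex_mean (letter_prob j a) = (letter_size j)%:R^-1.
Proof.
move=> aj; rewrite -(Kset_mean H_edge (Ordinal aj) (letter_mx_Kset j)).
congr vertex_mean; apply/funext => v.
by rewrite -letter_prob_ord.
Qed.

Lemma letter_prob_coin j : ~~ odd j -> forall a v, letter_prob j a v <= 2^-1.
Proof.
move=> jo a v; rewrite /letter_prob /letter_mx (negbTE jo); case: ifP => _; last first.
  by rewrite invr_ge0.
by rewrite mxE /letter_size /letter_target (negbTE jo).
Qed.

End one_graph.

Lemma letter_target_onto (t : target) : exists2 j, odd j & letter_target j = t.
Proof.
exists (pickle t).*2.+1; first by rewrite /= odd_double.
by rewrite /letter_target /= odd_double /= uphalf_double pickleK.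
Qed.

End letters.

Section limit_weights.
Variables (R : realType) (G : nat -> graph) (U : set_system nat).
Hypothesis G_edge : forall i, has_edge (G i).
Hypothesis U_ultra : UltraFilter U.

Let wp i : seq nat -> 'I_#|G i| -> R := word_prob (letter_prob R (H := G i)).

Definition limit_weight (w : seq nat) : R := ulim U (fun i => vertex_mean (@wp i w)).

Definition limit_pair_weight (w v : seq nat) : R :=
  ulim U (fun i => edge_mean (@wp i w) (@wp i v)).

Definition word_average (i m : nat) (F : seq nat -> R) (v : 'I_#|G i|) : R :=
  \sum_(w <- words letter_size m) F w * wp w v.

Let wp_bounds i w v : 0 <= @wp i w v <= 1.
Proof. by apply: word_prob_bounds => *; exact: letter_prob_bounds. Qed.

Let mean_bounds w i : 0 <= vertex_mean (@wp i w) <= 1.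
Proof. by apply: vertex_mean_bounds => // v; exact: wp_bounds. Qed.

Let edge_bounds w v i : 0 <= edge_mean (@wp i w) (@wp i v) <= 1.
Proof. by apply: edge_mean_bounds => // u; exact: wp_bounds. Qed.

Let wp_split i w : @wp i w =
  fun v => \sum_(a < letter_size (size w)) 1 * @wp i (nat_of_ord a :: w) v.
Proof.
by apply/funext => v; apply: word_prob_split => *; exact: letter_prob_sum.
Qed.

Lemma limit_weight_ge0 w : 0 <= limit_weight w.
Proof. by have /andP[] := ulim_bounds U_ultra (mean_bounds w) (mean_bounds w). Qed.

Lemma limit_weight_nil : limit_weight [::] = 1.
Proof.
apply: (ulim_eq U_ultra).
under eq_fun do rewrite vertex_mean_cst//; exact: cvg_cst.
Qed.

Lemma limit_weight_split w : limit_weight w =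
  \sum_(a < letter_size (size w)) limit_weight (nat_of_ord a :: w).
Proof.
under eq_bigr do rewrite -[limit_weight _]mul1r.
rewrite -(ulim_sum U_ultra) => [|a i]; last exact: mean_bounds.
congr ulim; apply/funext => i.
by rewrite -[LHS]/(vertex_mean _) wp_split vertex_mean_sum.
Qed.

(** This is what the coins are for: the limit law is nonatomic, so points can be
recovered from their digits. *)
Lemma limit_weight_small e : 0 < e ->
  exists m, forall w, size w = m -> limit_weight w <= e.
Proof.
move=> e0.
have [m me] := half_power_lt e0.
exists m.*2 => w sw; apply: le_trans (ltW me).
suff /andP[] : 0 <= limit_weight w <= 2^-1 ^+ m by [].
apply: (ulim_bounds U_ultra (mean_bounds w)) => i; apply/andP; split.
  by have /andP[] := mean_bounds w i.
rewrite -[leRHS](vertex_mean_cst (G_edge i)); apply: vertex_mean_mono => v.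
apply: word_prob_coins sw.
- by move=> *; exact: letter_prob_bounds.
- by move=> j jo a u; exact: letter_prob_coin.
Qed.

Lemma limit_pair_weight_ge0 w v : 0 <= limit_pair_weight w v.
Proof. by have /andP[] := ulim_bounds U_ultra (edge_bounds w v) (edge_bounds w v). Qed.

Lemma limit_pair_weight_nil : limit_pair_weight [::] [::] = 1.
Proof.
apply: (ulim_eq U_ultra).
under eq_fun do rewrite edge_mean1//; exact: cvg_cst.
Qed.

Lemma ulim_edge_mean (I : Type) (r r' : seq I) (c d : I -> R) (w v : I -> seq nat) :
  ulim U (fun i => edge_mean (fun u => \sum_(j <- r) c j * @wp i (w j) u)
                             (fun u => \sum_(j <- r') d j * @wp i (v j) u)) =
  \sum_(j <- r) \sum_(l <- r') c j * d l * limit_pair_weight (w j) (v l).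
Proof.
have UF : ProperFilter U := @ultra_proper _ _ U_ultra.
apply: (ulim_eq U_ultra).
under eq_fun do rewrite edge_mean_sum.
apply: (cvg_big add_continuous) => j _; apply: (cvg_big add_continuous) => l _.
by apply: cvgM; [exact: cvg_cst|exact: ulim_cvg].
Qed.

Lemma limit_pair_weight_split w v : size w = size v ->
  limit_pair_weight w v = \sum_(a < letter_size (size w))
    \sum_(b < letter_size (size w))
      limit_pair_weight (nat_of_ord a :: w) (nat_of_ord b :: v).
Proof.
move=> wv; under eq_bigr => a _ do under eq_bigr => b _ do
  rewrite -[limit_pair_weight _ _]mul1r -[1]mulr1.
rewrite -(ulim_edge_mean _ _ (fun=> 1) (fun=> 1) (fun a : 'I_(letter_size (size w)) => nat_of_ord a :: w)
  (fun b => nat_of_ord b :: v)).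
congr ulim; apply/funext => i; congr edge_mean; first by rewrite {1}wp_split.
by rewrite {1}wp_split wv.
Qed.

Lemma limit_weight_average m F :
  \sum_(w <- words letter_size m) limit_weight w * F w =
  ulim U (fun i => vertex_mean (word_average (i := i) m F)).
Proof.
under eq_bigr do rewrite mulrC.
rewrite -(ulim_sum U_ultra) => [|w i]; last exact: mean_bounds.
by congr ulim; apply/funext => i; rewrite vertex_mean_sum.
Qed.

Lemma limit_pair_weight_average m F H :
  \sum_(w <- words letter_size m) \sum_(v <- words letter_size m)
    limit_pair_weight w v * (F w * H v) =
  ulim U (fun i => edge_mean (word_average (i := i) m F) (word_average (i := i) m H)).
Proof.
rewrite ulim_edge_mean; apply: eq_bigr => w _; apply: eq_bigr => v _.
by rewrite mulrC.
Qed.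

Lemma word_average_bounds i m F v : (forall w, 0 <= F w <= 1) ->
  0 <= word_average (i := i) m F v <= 1.
Proof.
move=> F01; apply/andP; split.
  apply: sumr_ge0 => w _; rewrite mulr_ge0//; first by have /andP[] := F01 w.
  by have /andP[] := wp_bounds w v.
have <- : \sum_(w <- words letter_size m) @wp i w v = 1.
  by apply: sum_word_prob => *; exact: letter_prob_sum.
apply: ler_sum => w _; have /andP[? ?] := F01 w; have /andP[? ?] := wp_bounds w v.
by rewrite ler_piMl.
Qed.

Lemma word_average_sum i m k (F : 'I_k -> seq nat -> R) v :
  (forall w, \sum_a F a w = 1) -> \sum_a word_average (i := i) m (F a) v = 1.
Proof.
move=> F1; rewrite exchange_big /=.
under eq_bigr do rewrite -mulr_suml F1 mul1r.
by apply: sum_word_prob => *; exact: letter_prob_sum.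
Qed.

(** The function of words that tests one letter averages to the row of the matrix
from which that letter was drawn. *)
Lemma word_average_letter i j a : (a < letter_size j)%N ->
  word_average (i := i) j.+1 (fun w => (head 0%N w == a)%:R) = letter_prob R j a.
Proof.
move=> aj; apply/funext => v; apply: word_prob_last_letter => //.
by move=> *; exact: letter_prob_sum.
Qed.

End limit_weights.

(** * Hausdorff limits read entrywise *)

Section entrywise.
Variables (R : realType) (k : nat).
Implicit Types (X Y : 'M[R]_k) (S L : set 'M[R]_k).

Definition entries_near (e : R) X Y := forall a b, `|X a b - Y a b| < e.

Lemma entry_le_l1norm X a b : `|X a b| <= l1norm X.
Proof.
rewrite /l1norm (bigD1 a)//= (bigD1 b)//= -addrA lerDl addr_ge0// ?sumr_ge0// => *.
by rewrite sumr_ge0.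
Qed.

Lemma hausdorff_limit_near (A : nat -> set 'M[R]_k) L e :
  hausdorff_limit A L -> 0 < e -> \forall i \near \oo,
    (forall X, L X -> exists2 Y, A i Y & entries_near e X Y) /\
    (forall Y, A i Y -> exists2 X, L X & entries_near e X Y).
Proof.
move=> [_ _ AL] e0.
have near_e : \forall i \near \oo, (hausdorff_dist (A i) L < e%:E)%E.
  by apply: (@cvg_near_lte R nat \oo _ (fun i => hausdorff_dist (A i) L) 0%E _ AL); rewrite lte_fin.
apply: filterS near_e => i; rewrite /hausdorff_dist gt_max => /andP[h1 h2].
split.
- move=> X LX.
  have : (ereal_inf [set (l1norm (x - X))%:E | x in A i] < e%:E)%E.
    by apply: le_lt_trans h2; apply: ereal_sup_ubound; exists X.
  move=> /ereal_inf_lt[_ [Y AY <-]]; rewrite lte_fin => YX; exists Y => // a b.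
  rewrite distrC; apply: le_lt_trans YX.
  by have := entry_le_l1norm (Y - X) a b; rewrite !mxE.
- move=> Y AY.
  have : (ereal_inf [set (l1norm (Y - x))%:E | x in L] < e%:E)%E.
    by apply: le_lt_trans h1; apply: ereal_sup_ubound; exists Y.
  move=> /ereal_inf_lt[_ [X LX <-]]; rewrite lte_fin => YX; exists X => // a b.
  rewrite distrC; apply: le_lt_trans YX.
  by have := entry_le_l1norm (Y - X) a b; rewrite !mxE.
Qed.

Lemma closure_entriesP S X :
  closure S X <-> forall e, 0 < e -> exists2 Y, S Y & entries_near e X Y.
Proof.
split=> [clX e e0|h B /nbhs_ballP[e /= e0 eB]].
  have [Y [SY [_ XY]]] := clX _ (nbhsx_ballx X e e0).
  by exists Y => // a b; exact: XY.
by have [Y SY XY] := h e e0; exists Y; split=> //; apply: eB; split.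
Qed.

Lemma compact_entries L X : compact L ->
  (forall e, 0 < e -> exists2 Y, L Y & entries_near e X Y) -> L X.
Proof.
move=> cL h; have clL : closed L.
  by apply: compact_closed => //; exact: norm_hausdorff.
by apply: clL; apply/closure_entriesP.
Qed.

End entrywise.

Lemma rat_matrix_near (R : realType) k (X : 'M[R]_k) (e : R) : 0 < e ->
  exists q : 'M[rat]_k, forall a b, `|X a b - ratr (q a b)| < e.
Proof.
move=> e0.
have h (ab : 'I_k * 'I_k) : exists r : rat, `|X ab.1 ab.2 - ratr r| < e.
  have [r] : exists r : rat, ratr r \in `]X ab.1 ab.2 - e, X ab.1 ab.2 + e[.
    have lt : X ab.1 ab.2 - e < X ab.1 ab.2 + e by lra.
    by have [r hr] := rat_in_itvoo lt; exists r.
  by rewrite in_itv /= => /andP[r1 r2]; exists r; rewrite ltr_norml; apply/andP; split; lra.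
have [f hf] := choice h; exists (\matrix_(a, b) f (a, b)) => a b.
by rewrite mxE; exact: hf (a, b).
Qed.

(** * The limit measure *)

Section limit_measure.
Variables (R : realType) (G : nat -> graph) (U : set_system nat).
Hypothesis G_edge : forall i, has_edge (G i).
Hypothesis U_ultra : UltraFilter U.
Hypothesis oo_U : \oo `<=` U.

Let UF : ProperFilter U := @ultra_proper _ _ U_ultra.

Local Notation p := (limit_weight R G U).
Local Notation nu := (limit_pair_weight R G U).
Local Notation dec := (decode letter_size p).

Let size_gt0 j : (0 < letter_size j)%N.
Proof. by []. Qed.

Definition limit_measure : probability (measurableTypeR R * measurableTypeR R)%type R :=
  embedded_law letter_size p nu.

Let word_integral m F : (forall w, 0 <= F w) ->
  (\int[@lebesgue_measure R]_(x in unit_interval R) (F (prefix_word (dec x) m))%:E =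
   (ulim U (fun i => vertex_mean (@word_average R G i m F)))%:E)%E.
Proof.
move=> F0; rewrite decoded_integral//; first by rewrite limit_weight_average.
- exact: limit_weight_ge0.
- exact: limit_weight_nil.
- exact: limit_weight_split.
Qed.

Let pair_integral m F H : (forall w, 0 <= F w) -> (forall w, 0 <= H w) ->
  (\int[limit_measure]_(q in unit_square R)
     (F (prefix_word (dec q.1) m) * H (prefix_word (dec q.2) m))%:E =
   (ulim U (fun i => edge_mean (@word_average R G i m F) (@word_average R G i m H)))%:E)%E.
Proof.
move=> F0 H0; rewrite decoded_pair_integral//; first by rewrite limit_pair_weight_average.
- exact: limit_pair_weight_ge0.
- exact: limit_pair_weight_nil.
- exact: limit_pair_weight_split.
Qed.

Lemma limit_measure_square : limit_measure (unit_square R) = 1%E.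
Proof.
have msq : measurable (unit_square R) by apply: measurableX; exact: measurable_itv.
have := @pair_integral 0 (fun=> 1) (fun=> 1) (fun=> ler01) (fun=> ler01).
rewrite integral_cst// mulr1 mul1e => ->; congr EFin; apply: (ulim_eq U_ultra).
have one i : @word_average R G i 0 (fun=> 1) = fun=> 1.
  by apply/funext => v; rewrite /word_average big_seq1 mul1r.
by under eq_fun do rewrite one edge_mean1//; exact: cvg_cst.
Qed.

(** Near [X] choose a rational matrix [q]. By convergence, [q] is hit in all late
graphs, so the letters drawn for this target have statistics near [q], and so
has their ultralimit, which is realized exactly by the indicators of the values
of that letter. *)
Lemma limit_subset_Cmeas k (L : set 'M[R]_k) : (0 < k)%N ->
  hausdorff_limit (fun i => C0 R (G i) k) L -> L `<=` Cmeas limit_measure k.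
Proof.
case: k L => // k L _ GL X LX; apply/closure_entriesP => e e0.
pose N := Num.truncn (2 / e).
pose d : R := N.+1%:R^-1.
have d0 : 0 < d by rewrite invr_gt0.
have d2e : d + d <= e.
  have : 2 / e < N.+1%:R by exact: truncnS_gt.
  rewrite ltr_pdivrMr// => h.
  rewrite -mulr2n -[_ *+ 2]mulr_natl /d ler_pdivrMr ?ltr0n// mulrC; exact: ltW.
have d20 : 0 < d / 2 by rewrite divr_gt0.
(* Half of the tolerance [d] of the target is spent here, the other half on the
   Hausdorff distance, so that the target is hit in all late graphs. *)
have [q Xq] := rat_matrix_near X d20.
have [j jodd jt] := letter_target_onto (existT _ k (q, N) : target).
have jk : letter_size j = k.+1 by rewrite /letter_size jt.
have prob01 i a v := letter_prob_bounds R (H := G i) j a v.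
have mean01 a b i : 0 <= edge_mean (letter_prob R (H := G i) j a)
    (letter_prob R (H := G i) j b) <= 1 by apply: edge_mean_bounds.
pose Y : 'M[R]_k.+1 := \matrix_(a, b) ulim U (fun i =>
  edge_mean (letter_prob R (H := G i) j a) (letter_prob R (H := G i) j b)).
have Yq a b : `|Y a b - ratr (q a b)| <= d.
  rewrite mxE; apply: (ulim_near_le U_ultra); first exact: mean01.
  apply: filterS (oo_U (hausdorff_limit_near GL d20)) => i [/(_ X LX)[Z [_ [M KM <-] <-] XZ] _].
  have hM : hits q N M.
    move=> a' b'; rewrite -C0_entry distrC.
    have := XZ a' b'; have := Xq a' b'; rewrite -/d.
    set r := ratr _; set z := (z in `|_ - z| <= _); set x := X a' b' => h1 h2.
    have -> : r - z = (x - z) - (x - r) by ring.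
    rewrite (le_trans (ler_normB _ _))// (splitr d) lerD// ltW//.
  have := letter_mx_hits jt jodd (ex_intro2 _ _ M KM hM) (ltn_ord a) (ltn_ord b).
  by rewrite !inord_val.
exists Y; last first.
  move=> a b; apply: lt_le_trans d2e.
  have -> : X a b - Y a b = (X a b - ratr (q a b)) - (Y a b - ratr (q a b)) by ring.
  rewrite (le_lt_trans (ler_normB _ _))// ltr_leD//.
  by apply: lt_trans (Xq a b) _; lra.
pose F (a : nat) (w : seq nat) : R := (head 0%N w == a)%:R.
have F0 a w : 0 <= F a w by rewrite ler0n.
exists (fun a x => F a (prefix_word (dec x) j.+1)).
  split.
  - move=> a; apply: measurable_funTS.
    exact: (measurableT_comp (measurable_word_fun j.+1 (F a)) (measurable_decode _ _)).
  - by move=> a x _; exact: F0.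
  - move=> x _; have jx : (dec x j < k.+1)%N by rewrite -jk; exact: decode_lt.
    rewrite (bigD1 (Ordinal jx))//= /F /= eqxx big1 ?addr0// => a.
    by rewrite -val_eqE /= eq_sym => /negbTE ->.
  - move=> a; rewrite word_integral//; congr EFin; apply: (ulim_eq U_ultra).
    under eq_fun do rewrite word_average_letter ?jk// letter_prob_mean ?jk//.
    exact: cvg_cst.
move=> a b; rewrite mxE pair_integral//; congr (ulim _ _)%:E; apply/funext => i.
by rewrite !word_average_letter ?jk.
Qed.

(** A partition of words that approximates a given fractional partition is
averaged over the words of each vertex. Along the ultrafilter the resulting
functions have almost the right means and matrix, so some late graph has, after
adjustment, an element of C_0 close to the given matrix. *)
Lemma Cmeas_subset_limit k (L : set 'M[R]_k) : (0 < k)%N ->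
  hausdorff_limit (fun i => C0 R (G i) k) L -> Cmeas limit_measure k `<=` L.
Proof.
move=> k0 GL; have [_ cL _] := GL.
have clL : closed L by apply: compact_closed => //; exact: norm_hausdorff.
suff SL : [set M : 'M[R]_k |
    exists2 f : 'I_k -> measurableTypeR R -> R, fractional_partition f &
      forall i j, (M i j)%:E =
        (\int[limit_measure]_(q in unit_square R) (f i q.1 * f j q.2)%:E)%E ] `<=` L.
  by apply: subset_trans (closure_subset SL) _; rewrite -(closure_id L).1.
move=> X [f [mf f0 f1 fk] Xf]; apply: compact_entries => // e e0.
(* Five errors of size [d] add up: approximation and ultralimit (two), the
   adjustment (two), the Hausdorff distance (one). *)
pose d := Num.min 1 (e / 6).
have d0 : 0 < d by rewrite lt_min ltr01 divr_gt0.
have d1 : d <= 1 by rewrite ge_min lexx.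
have de : d <= e / 6 by rewrite ge_min lexx orbT.
have k0R : (0 : R) < k%:R by rewrite ltr0n.
pose c := d / k%:R / 2.
have c0 : 0 < c by rewrite !divr_gt0.
have cd : c <= d.
  rewrite /c -mulrA ler_piMr ?(ltW d0)// -invfM invf_le1 ?mulr_gt0//.
  by rewrite -natrM ler1n muln_gt0 k0.
have [m [F [F0 F1 Fmean Fedge]]] := @approximate_integrals R letter_size p nu size_gt0
  (@limit_weight_ge0 R G U G_edge U_ultra) (@limit_weight_nil R G U G_edge U_ultra)
  (@limit_weight_split R G U G_edge U_ultra) (@limit_weight_small R G U G_edge U_ultra)
  (@limit_pair_weight_ge0 R G U G_edge U_ultra) (@limit_pair_weight_nil R G U G_edge U_ultra)
  (@limit_pair_weight_split R G U G_edge U_ultra) k f k0 mf f0 f1 c c0.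
have F01 a w : 0 <= F a w <= 1.
  by rewrite F0 -(F1 w) (bigD1 a)//= lerDl sumr_ge0.
pose av i a : 'I_#|G i| -> R := @word_average R G i m (F a).
have av01 i a v : 0 <= av i a v <= 1 by exact: word_average_bounds.
have near_mean : \forall i \near U, forall a, `|k%:R^-1 - vertex_mean (av i a)| <= d / k%:R.
  apply: filter_forall => a.
  have := Fmean a _ (fk a); rewrite limit_weight_average// => /(near_ulim U_ultra _ c0).
  have -> : c + c = d / k%:R by rewrite [RHS]splitr.
  by apply => i; apply: vertex_mean_bounds => // v; exact: av01.
have near_edge : \forall i \near U, forall a b, `|X a b - edge_mean (av i a) (av i b)| <= d + d.
  apply: filter_forall => a; apply: filter_forall => b.
  have := Fedge a b _ (esym (Xf a b)); rewrite limit_pair_weight_average//.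
  move=> /le_trans/(_ cd)/(near_ulim U_ultra _ d0).
  by apply => i; apply: edge_mean_bounds => // v; exact: av01.
have [i [[mi ei] [_ Li]]] := filter_ex (filterI (filterI near_mean near_edge)
  (oo_U (hausdorff_limit_near GL d0))).
have [|a v|v|M KM Me] := @adjust_to_Kset R (G i) (G_edge i) k (av i) d k0 _ _ _ mi.
- by rewrite d0.
- by have /andP[] := av01 i a v.
- exact: word_average_sum.
have [Z LZ ZY] := Li _ (ex_intro2 _ _ _ (ex_intro2 _ _ M KM erefl) erefl).
exists Z => // a b.
have := ZY a b; rewrite C0_entry; have := Me a b; have := ei a b.
set x := X a b; set y := edge_mean _ _; set y' := edge_mean _ _; set z := Z a b.
move=> h1 h2 h3.
have -> : x - z = (x - y) - (y' - y) - (z - y') by ring.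
rewrite (le_lt_trans (ler_normB _ _))//.
have := ler_normB (x - y) (y' - y); lra.
Qed.

End limit_measure.

Theorem theorem4p5 (R : realType) (G : nat -> graph)
    (G_edge : forall i, has_edge (G i))
    (G_cvg : s_convergent R G) :
  exists mu : probability (measurableTypeR R * measurableTypeR R)%type R,
    mu (unit_square R) = 1%E /\
    forall k, (0 < k)%N ->
      hausdorff_limit (fun i => C0 R (G i) k) (Cmeas mu k).
Proof.
have [U [U_ultra oo_U]] := ultraFilterLemma (@eventually_filter).
exists (limit_measure R G U); split; first exact: limit_measure_square.
move=> k k0; have [L GL] := G_cvg k k0.
suff -> : Cmeas (limit_measure R G U) k = L by [].
by apply/seteqP; split; [exact: Cmeas_subset_limit|exact: limit_subset_Cmeas].
Qed.
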